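(* Let the switched system with known affine terms $b_i$, the standing assumptions (Lipschitz nonlinearities with constant $\kappa>0$; observability and simultaneous quadratic stability with fixed gains $L_1,\dots,L_\ell$), the extended observer, the matrices $\bar A_i,\bar C,\bar L_i,\bar X_i,E,\bar Y_{1,j},\bar Y_{2,j}$, the switching law, the functions $\bar P_i$, the matrices $\bar\Psi_i(t)$ and the costs $J,\hat J$ be as in the context. Let $\varepsilon,\zeta,T>0$, symmetric $X_i\succ0$ in $\mathbb R^{n\times n}$ ($i\in[\ell]$) and $\Pi\in\mathcal M_\ell$ satisfy $$\bar A_i^\top\bar X_i+\bar X_i\bar A_i+\sum_{j\in[\ell]\setminus\{i\}}\Pi_{ij}\,(\bar Y_{1,j}+\bar Y_{2,j}-\bar X_i)+\bar C^\top\bar C+2\zeta\bar X_i\prec\varepsilon E,\qquad i\in[\ell].$$ Given $h>0$, $\alpha>0$ and $\kappa>0$, suppose there exist symmetric $Q\succ0$, $W\succ0$ in $\mathbb R^{n\times n}$ and a scalar $\gamma>0$ such that $\bar\Psi_i(t)\prec0$ for all $i\in[\ell]$ and all $t\in[0,T]$. Let $\mathcal C_1,\mathcal C_3>0$ be (explicitly computable) constants with $\bar P_i(t)\succeq\mathcal C_1I_{n+1}$ for all $i\in[\ell]$, $t\in[0,T]$, and $Q\succeq\mathcal C_3I_n$. Then, with $\overline B_1:=\dfrac{\varepsilon}{2\alpha\min(\mathcal C_1,\mathcal C_3)}$, every solution of the closed-loop system satisfies $$\limsup_{t\to\infty}\big(\|\varphi(t)\|^2+\|e(t)\|^2\big)\le\overline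 B_1,\qquad\limsup_{t\to\infty}\|x(t)\|^2\le2\overline B_1,$$ $$\limsup_{t\to\infty}|J(t)-\hat J(t)|\le3\,\|C^\top C\|\,\overline B_1^{2} .$$
   Context: Notation: $[\ell]=\{1,\dots,\ell\}$; $\|\cdot\|$ is the Euclidean norm and the induced operator norm; $\prec,\succ,\succeq$ denote the definiteness order on symmetric matrices; $\star$ denotes entries determined by symmetry. $\mathcal M_\ell$ is the class of irreducible matrices $\Pi\in\mathbb R^{\ell\times\ell}$ with $\Pi_{ij}\ge0$ for $i\ne j$ and $\sum_{j}\Pi_{ij}=0$ for all $i$. System: $x(t)\in\mathbb R^n$, $$\dot x(t)=A_{\sigma(t)}x(t)+b_{\sigma(t)}+f_{\sigma(t)}(x(t)),\quad y(t)=D_{\sigma(t)}x(s_k)\ (t\in[s_k,s_{k+1})),\quad z(t)=Cx(t),$$ with $\sigma:\mathbb R_{\ge0}\to[\ell]$ piecewise constant, $A_i\in\mathbb R^{n\times n}$, $D_i\in\mathbb R^{m\times n}$, $C\in\mathbb R^{p\times n}$, known $b_i\in\mathbb R^n$, and arbitrary unknown $x(0)$. The sampling instants satisfy $s_0=0$, $0<s_{k+1}-s_k\le h$, $s_k\to\infty$, and are otherwise arbitrary. Standing assumptions: (1) $f_i:\mathbb R^n\to\mathbb R^n$, $f_i(0)=0$ and $\|f_i(x)-f_i(y)\|\le\kappa\|x-y\|$ for all $x,y$ and $i\in[\ell]$. (2) Each pair $(A_i,D_i)$ is observable, and $L_i\in\mathbb R^{n\times m}$ are fixed such that each $U_i:=A_i-L_iD_i$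 is Hurwitz and there exist a symmetric $\Omega\succ0$ and $\eta>0$ with $\Phi_i(\eta,\Omega)\prec0$ for all $i\in[\ell]$, where $\Phi_i(\eta,\Omega):=U_i^\top\Omega+\Omega U_i+2\eta\Omega$. Extended matrices: $\bar A_i=\begin{bmatrix}A_i&b_i\\0&0\end{bmatrix}\in\mathbb R^{(n+1)\times(n+1)}$, $\bar C=[\,C\ \ 0\,]\in\mathbb R^{p\times(n+1)}$, $\bar L_i=\begin{bmatrix}L_i\\0\end{bmatrix}\in\mathbb R^{(n+1)\times m}$, $\bar D_i=[\,D_i\ \ 0\,]\in\mathbb R^{m\times(n+1)}$, $\bar X_i=\begin{bmatrix}X_i&0\\0&1\end{bmatrix}$, $E=\begin{bmatrix}0&0\\0&1\end{bmatrix}\in\mathbb R^{(n+1)\times(n+1)}$, $\bar Y_{1,j}=\mathrm e^{(\bar A_j^\top+\zeta I)T}\bar X_j\mathrm e^{(\bar A_j+\zeta I)T}$, $\bar Y_{2,j}=\int_0^T\mathrm e^{(\bar A_j^\top+\zeta I)\tau}\bar C^\top\bar C\,\mathrm e^{(\bar A_j+\zeta I)\tau}d\tau$. Observer: $\bar\varphi(t)=\begin{bmatrix}\varphi(t)\\1\end{bmatrix}$, $\dot{\bar\varphi}(t)=\bar A_{\sigma(t)}\bar\varphi(t)+\bar L_{\sigma(t)}D_{\sigma(t)}[x(s_k)-\varphi(s_k)]$ for $t\in[s_k,s_{k+1})$, with $\varphi(0)=0$; equivalently $\dot\varphi=A_\sigma\varphi+b_\sigma+L_\sigma D_\sigma[x(s_k)-\varphi(s_k)]$.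 The error is $e(t)=x(t)-\varphi(t)$. Solutions are absolutely continuous and satisfy the ODEs outside a locally finite set of times. Switching law (dwell time $T$): $t_0=0$ with arbitrary initial mode. If the mode selected at $t_k$ is $i$, then $\sigma(t)=i$ on $[t_k,t_{k+1})$, where $t_{k+1}=\inf\{t>t_k+T:\ \exists j\in[\ell]\setminus\{i\},\ \bar\varphi(t)^\top(\bar Y_{1,j}+\bar Y_{2,j}-\bar X_i)\bar\varphi(t)<0\}$ ($=\infty$ if the set is empty, in which case no more switches occur); if $t_{k+1}<\infty$, then $\sigma(t_{k+1})\in\operatorname{argmin}_{j\in[\ell]\setminus\{i\}}\bar\varphi(t_{k+1})^\top(\bar Y_{1,j}+\bar Y_{2,j})\bar\varphi(t_{k+1})$. The closed-loop system is the system together with the observer and this switching law. $\bar P_i:[0,T]\to\mathbb R^{(n+1)\times(n+1)}$ is the (symmetric positive definite) solution of $-\dot{\bar P}_i(t)=\bar A_i^\top\bar P_i(t)+\bar P_i(t)\bar A_i+\bar C^\top\bar C+2\zeta\bar P_i(t)$ on $[0,T)$ with $\bar P_i(T)=\bar X_i$. With $c:=h^2\mathrm e^{2\alpha h}$, $\Omega_1=\begin{bmatrix}I_n&0\\0&0\end{bmatrix}\in\mathbb R^{(n+1)\times(n+1)}$, $\Omega_2=\begin{bmatrix}I_n\\0\end{bmatrix}\in\mathbb R^{(n+1)\times n}$, $$\bar\Psi_i(t)=\begin{bmatrix}-2(\zeta-\alpha)\bar P_i(t)+\gamma\kappa^2\Omega_1 & \bar P_i(t)\bar L_iD_i+\gamma\kappa^2\Omega_2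 & -\bar P_i(t)\bar L_iD_i & 0\\ \star&\Phi_i(\alpha,Q)+\gamma\kappa^2I_n+cU_i^\top WU_i& QL_iD_i+cU_i^\top WL_iD_i& Q+cU_i^\top W\\ \star&\star&-\frac{\pi^2}{4}W+cD_i^\top L_i^\top WL_iD_i& cD_i^\top L_i^\top W\\ \star&\star&\star&-\gamma I_n+cW\end{bmatrix}.$$ Costs: $J(t)=\frac1t\int_0^t z(\tau)^\top z(\tau)\,d\tau$ and $\hat J(t)=\frac1t\int_0^t\varphi(s)^\top C^\top C\varphi(s)\,ds$ for $t>0$. *)

(* Defs.v *)
From HB Require Import structures.
From mathcomp Require Export all_boot all_order all_algebra.
From mathcomp Require Export all_classical all_reals all_analysis.
From mathcomp Require Export complex.

Set Implicit Arguments.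
Unset Strict Implicit.
Unset Printing Implicit Defensive.

Import Order.TTheory GRing.Theory Num.Theory.
Import numFieldNormedType.Exports.

Local Open Scope classical_set_scope.
Local Open Scope ring_scope.

Section LinearAlgebra.
Context {R : realType}.

(* The library norm on matrices is the max norm, hence the explicit
   Euclidean norm. *)
Definition enorm n (x : 'cV[R]_n) : R := Num.sqrt (\sum_i x i 0 ^+ 2).

Definition opnorm m n (M : 'M[R]_(m, n)) : R :=
  sup [set enorm (M *m x) | x in [set x : 'cV[R]_n | enorm x <= 1]].

Definition qform n (M : 'M[R]_n) (x : 'cV[R]_n) : R := (x^T *m M *m x) 0 0.

Definition posdef n (M : 'M[R]_n) : Prop :=
  M^T = M /\ forall x : 'cV[R]_n, x != 0 -> 0 < qform M x.

Definition possemidef n (M : 'M[R]_n) : Prop :=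
  M^T = M /\ forall x : 'cV[R]_n, 0 <= qform M x.

Definition mxlt n (M N : 'M[R]_n) : Prop := posdef (N - M).

Definition mxle n (M N : 'M[R]_n) : Prop := possemidef (N - M).

Definition Hurwitz n (M : 'M[R]_n) : Prop :=
  forall a : R[i], eigenvalue (map_mx (real_complex R) M) a -> complex.Re a < 0.

(* Kalman: [D; DA; ...; DA^(n-1)] has full column rank. *)
Definition observable m n (A : 'M[R]_n) (D : 'M[R]_(m, n)) : Prop :=
  \rank (\mxcol_(k < n) (D *m A ^+ k)) = n.

(* No proper nonempty subset of indices is closed under the edges of M; in
   particular every 1 x 1 matrix is irreducible. *)
Definition irreducible_mx n (M : 'M[R]_n) : Prop :=
  forall S : {set 'I_n}, (exists i, i \in S) -> (exists j, j \notin S) ->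
    exists i j, [/\ i \in S, j \notin S & M i j != 0].

Definition rate_matrix n (M : 'M[R]_n) : Prop :=
  [/\ irreducible_mx M, forall i j, i != j -> 0 <= M i j
    & forall i, \sum_j M i j = 0].

Definition expmx n (M : 'M[R]_n) : 'M[R]_n :=
  lim (series (fun k : nat => (k`!%:R)^-1 *: M ^+ k) @ \oo).

Definition sym_block4 n1 n2 n3 n4
    (M11 : 'M[R]_n1) (M12 : 'M[R]_(n1, n2)) (M13 : 'M[R]_(n1, n3))
    (M14 : 'M[R]_(n1, n4)) (M22 : 'M[R]_n2) (M23 : 'M[R]_(n2, n3))
    (M24 : 'M[R]_(n2, n4)) (M33 : 'M[R]_n3) (M34 : 'M[R]_(n3, n4))
    (M44 : 'M[R]_n4) : 'M[R]_((n1 + n2) + (n3 + n4)) :=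
  block_mx (block_mx M11 M12 M12^T M22)
           (block_mx M13 M14 M23 M24)
           (block_mx M13^T M23^T M14^T M24^T)
           (block_mx M33 M34 M34^T M44).

End LinearAlgebra.

Section Calculus.
Context {R : realType}.

(* Derivative at t relative to the domain D (one-sided at an endpoint). *)
Definition is_derive_within (V : normedModType R) (D : set R) (t : R)
    (F : R -> V) (dF : V) : Prop :=
  (s - t)^-1 *: (F s - F t) @[s --> within D t^'] --> dF.

Definition abs_continuous_on n (a b : R) (x : R -> 'cV[R]_n) : Prop :=
  forall e : R, 0 < e -> exists2 d : R, 0 < d &
    forall (N : nat) (u v : nat -> R),
      (forall i, (i < N)%N -> a <= u i /\ u i <= v i /\ v i <= b) ->
      trivIset [set i | (i < N)%N] (fun i => `]u i, v i[%classic) ->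
      \sum_(i < N) (v i - u i) < d ->
      \sum_(i < N) enorm (x (v i) - x (u i)) < e.

Definition loc_abs_continuous n (x : R -> 'cV[R]_n) : Prop :=
  forall b : R, 0 <= b -> abs_continuous_on 0 b x.

Definition locally_finite (S : set R) : Prop :=
  forall b : R, finite_set (S `&` `[0, b]).

Definition limsup_infty (g : R -> R) : \bar R :=
  limf_esup (fun t => (g t)%:E) (pinfty_nbhs R).

End Calculus.

Section ExtendedMatrices.
Context {R : realType} {n m p : nat}.
Implicit Types (A X Q W U : 'M[R]_n) (b : 'cV[R]_n) (C : 'M[R]_(p, n)).
Implicit Types (D : 'M[R]_(m, n)) (L : 'M[R]_(n, m)).

Definition extA A b : 'M[R]_(n + 1) := block_mx A b 0 0.
Definition extC C : 'M[R]_(p, n + 1) := row_mx C 0.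
Definition extL L : 'M[R]_(n + 1, m) := col_mx L 0.
Definition extX X : 'M[R]_(n + 1) := block_mx X 0 0 1%:M.
Definition extE : 'M[R]_(n + 1) := block_mx 0 0 0 1%:M.
Definition extv (phi : 'cV[R]_n) : 'cV[R]_(n + 1) := col_mx phi 1%:M.
Definition Omega1 : 'M[R]_(n + 1) := block_mx 1%:M 0 0 0.
Definition Omega2 : 'M[R]_(n + 1, n) := col_mx 1%:M 0.

Definition Y1 (zeta T : R) A b X : 'M[R]_(n + 1) :=
  expmx (T *: ((extA A b)^T + zeta%:M)) *m extX X
    *m expmx (T *: (extA A b + zeta%:M)).

Definition Y2 (zeta T : R) A b C : 'M[R]_(n + 1) :=
  \matrix_(i, j) \int[lebesgue_measure]_(tau in `[0, T])
    (expmx (tau *: ((extA A b)^T + zeta%:M)) *m (extC C)^T *m extC C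
       *m expmx (tau *: (extA A b + zeta%:M))) i j.

(* The ODE at t = 0 is understood with the right derivative, and the terminal
   value is attained continuously. *)
Definition is_Pbar (zeta T : R) A b C X (P : R -> 'M[R]_(n + 1)) : Prop :=
  [/\ {within `[0, T], continuous P}, P T = extX X
    & forall t : R, 0 <= t < T -> is_derive_within `[0, T] t P
        (- ((extA A b)^T *m P t + P t *m extA A b
            + (extC C)^T *m extC C + (2 * zeta) *: P t))].

Definition Phi (eta : R) (Omega U : 'M[R]_n) : 'M[R]_n :=
  U^T *m Omega + Omega *m U + (2 * eta) *: Omega.

Definition Psi (zeta alpha gamma kappa h : R) (Q W A : 'M[R]_n) D L
    (P : 'M[R]_(n + 1)) : 'M[R]_((n + 1 + n) + (n + n)) :=
  let c := h ^+ 2 * expR (2 * alpha * h) in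
  let U := A - L *m D in
  let LD := L *m D in
  sym_block4
    (- (2 * (zeta - alpha)) *: P + (gamma * kappa ^+ 2) *: Omega1)
    (P *m extL L *m D + (gamma * kappa ^+ 2) *: Omega2)
    (- (P *m extL L *m D))
    0
    (Phi alpha Q U + (gamma * kappa ^+ 2)%:M + c *: (U^T *m W *m U))
    (Q *m LD + c *: (U^T *m W *m LD))
    (Q + c *: (U^T *m W))
    (- (pi ^+ 2 / 4) *: W + c *: (LD^T *m W *m LD))
    (c *: (LD^T *m W))
    (- gamma%:M + c *: W).

End ExtendedMatrices.

Section ClosedLoop.
Context {R : realType} {n m p l : nat}.
Variables (A : 'I_l -> 'M[R]_n) (b : 'I_l -> 'cV[R]_n).
Variables (D : 'I_l -> 'M[R]_(m, n)) (C : 'M[R]_(p, n)).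
Variables (L : 'I_l -> 'M[R]_(n, m)) (f : 'I_l -> 'cV[R]_n -> 'cV[R]_n).
Variables (zeta T : R) (X : 'I_l -> 'M[R]_n) (h : R).

Definition sampling_instants (s : nat -> R) : Prop :=
  [/\ s 0%N = 0, forall k, 0 < s k.+1 - s k <= h & s @ \oo --> +oo].

(* The switching times are extended reals: t_{k+1} = +oo means that no switch
   occurs after t_k, and then also t_{k+2} = +oo and so on, so that the values
   of the mode sequence beyond k are irrelevant. *)
Definition switching_law (phi : R -> 'cV[R]_n) (sigma : R -> 'I_l) : Prop :=
  let Y j := Y1 zeta T (A j) (b j) (X j) + Y2 zeta T (A j) (b j) C in
  exists (tsw : nat -> \bar R) (mode : nat -> 'I_l),
  [/\ tsw 0%N = 0%E,
      forall k (t : R), (tsw k <= t%:E)%E -> (t%:E < tsw k.+1)%E ->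
        sigma t = mode k,
      forall k, tsw k.+1 = ereal_inf [set t%:E | t in
        [set t : R | (tsw k + T%:E < t%:E)%E /\
           exists2 j, j != mode k &
             qform (Y j - extX (X (mode k))) (extv (phi t)) < 0]]
    & forall k, (tsw k.+1 < +oo)%E ->
        let phib := extv (phi (fine (tsw k.+1))) in
        mode k.+1 != mode k /\
        forall j, j != mode k -> qform (Y (mode k.+1)) phib <= qform (Y j) phib].

Definition closed_loop_solution (s : nat -> R) (sigma : R -> 'I_l)
    (x phi : R -> 'cV[R]_n) : Prop :=
  [/\ loc_abs_continuous x, loc_abs_continuous phi, phi 0 = 0,
      exists2 S : set R, locally_finite S &
        forall k (t : R), s k <= t < s k.+1 -> 0 < t -> ~ S t ->
          let i := sigma t in
          is_derive t 1 x (A i *m x t + b i + f i (x t)) /\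
          is_derive t 1 (fun r => extv (phi r))
            (extA (A i) (b i) *m extv (phi t)
             + extL (L i) *m D i *m (x (s k) - phi (s k)))
    & switching_law phi sigma].

Definition Jcost (x : R -> 'cV[R]_n) (t : R) : R :=
  t^-1 * \int[lebesgue_measure]_(tau in `[0, t])
    ((C *m x tau)^T *m (C *m x tau)) 0 0.

Definition Jhat (phi : R -> 'cV[R]_n) (t : R) : R :=
  t^-1 * \int[lebesgue_measure]_(tau in `[0, t])
    ((phi tau)^T *m C^T *m C *m phi tau) 0 0.

End ClosedLoop.

(* Main.v *)
Require Import Defs.
From mathcomp Require Import ring lra.
Import Order.TTheory GRing.Theory Num.Theory.
Import numFieldNormedType.Exports.
Local Open Scope classical_set_scope.
Local Open Scope ring_scope.

Set Implicit Arguments.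
Unset Strict Implicit.
Unset Printing Implicit Defensive.

(* With [v t = e t - e s_k] and [tau = t - t_j] the time since the last switch,
   the function
     V = phib^T P(min(tau, T)) phib + e^T Q e + g(t - s_k) v^T W v,
     g(r) = exp(2 alpha (h - r)) (h pi / 2) cot(pi r / (2 h)),
   satisfies V' + 2 alpha V <= eps between events: the last term replaces the
   usual Wirtinger integral functional, as g solves the corresponding Riccati
   inequality, and v vanishes fast enough at s_k to compensate the pole of g.
   At a sampling instant the last term drops to 0; at a switching time the
   first one does not increase because Y1 + Y2 = P(0).  Real induction then
   gives V <= eps / (2 alpha) + O(exp(-2 alpha t)).  Since phib has last entry
   1, min(C1, C3) (|phi|^2 + 1 + |e|^2) <= V, so that B1 >= 1 and the bound
   2 |C^T C| B1 on the cost gap is below 3 |C^T C| B1^2. *)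

(** * Bilinear forms and norms *)

(** The matrix [Psi] is what remains of V' + 2 alpha V after three estimates. The bound |f(x)| <=
    kappa |phi + e| enters with multiplier gamma. The cross term 2 g v^T W e' is split by Young's
    inequality into c e'^T W e' and (g^2 / c) v^T W v, with c = h^2 exp(2 alpha h). The Riccati
    inequality bounds g' + 2 alpha g + g^2 / c by - pi^2 / 4. This is the origin of the entries
    built from c W and - pi^2 / 4 W. The constant eps is the value of [eps *: extE] on a vector with
    last entry 1. The obstacle is the number of unrelated exceptional times: sampling instants and
    switching times may coincide, the equations fail on a locally finite set, and P(min(tau, T)) has
    a corner at tau = T. The comparison therefore asks, at each time, only for a smooth
    representative of V just to the right and for a continuous one from the left that dominates V at
    that time; events are never enumerated in a common order. A pointwise weight g fits this scheme,
    since it uses e' only where it exists and no integral of it. *)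

Section BilinearForms.
Context {R : realType}.

Definition bform m n (M : 'M[R]_(m, n)) (x : 'cV[R]_m) (y : 'cV[R]_n) : R :=
  (x^T *m M *m y) 0 0.

Lemma qformE n (M : 'M[R]_n) x : qform M x = bform M x x.
Proof. by []. Qed.

Lemma bformDl m n (M : 'M[R]_(m, n)) x1 x2 y :
  bform M (x1 + x2) y = bform M x1 y + bform M x2 y.
Proof. by rewrite /bform linearD/= !mulmxDl mxE. Qed.

Lemma bformDr m n (M : 'M[R]_(m, n)) x y1 y2 :
  bform M x (y1 + y2) = bform M x y1 + bform M x y2.
Proof. by rewrite /bform mulmxDr mxE. Qed.

Lemma bformNl m n (M : 'M[R]_(m, n)) x y : bform M (- x) y = - bform M x y.
Proof. by rewrite /bform linearN/= !mulNmx mxE. Qed.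

Lemma bformNr m n (M : 'M[R]_(m, n)) x y : bform M x (- y) = - bform M x y.
Proof. by rewrite /bform mulmxN mxE. Qed.

Lemma bformZl m n (M : 'M[R]_(m, n)) a x y :
  bform M (a *: x) y = a * bform M x y.
Proof. by rewrite /bform linearZ/= -!scalemxAl mxE. Qed.

Lemma bformZr m n (M : 'M[R]_(m, n)) a x y :
  bform M x (a *: y) = a * bform M x y.
Proof. by rewrite /bform -!scalemxAr mxE. Qed.

Lemma bformDm m n (M N : 'M[R]_(m, n)) x y :
  bform (M + N) x y = bform M x y + bform N x y.
Proof. by rewrite /bform mulmxDr mulmxDl mxE. Qed.

Lemma bformNm m n (M : 'M[R]_(m, n)) x y : bform (- M) x y = - bform M x y.
Proof. by rewrite /bform mulmxN mulNmx mxE. Qed.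

Lemma bformZm m n (M : 'M[R]_(m, n)) a x y :
  bform (a *: M) x y = a * bform M x y.
Proof. by rewrite /bform -scalemxAr -scalemxAl mxE. Qed.

Lemma bform0m m n x y : bform (0 : 'M[R]_(m, n)) x y = 0.
Proof. by rewrite /bform mulmx0 mul0mx mxE. Qed.

Lemma bform_scalar n (a : R) (x y : 'cV[R]_n) :
  bform a%:M x y = a * bform 1%:M x y.
Proof. by rewrite -bformZm scalemx1. Qed.

Lemma bform_tr m n (M : 'M[R]_(m, n)) x y : bform M^T y x = bform M x y.
Proof.
have -> : bform M x y = (x^T *m M *m y)^T 0 0 by rewrite mxE.
by rewrite /bform !trmx_mul trmxK mulmxA.
Qed.

Lemma bformC n (M : 'M[R]_n) x y : M^T = M -> bform M x y = bform M y x.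
Proof. by move=> MT; rewrite -bform_tr MT. Qed.

Lemma bformMr m n k (M : 'M[R]_(m, n)) (N : 'M[R]_(n, k)) x y :
  bform (M *m N) x y = bform M x (N *m y).
Proof. by rewrite /bform !mulmxA. Qed.

Lemma bformMl m n k (M : 'M[R]_(m, n)) (N : 'M[R]_(n, k)) x y :
  bform (M *m N) x y = bform N (M^T *m x) y.
Proof. by rewrite /bform trmx_mul trmxK !mulmxA. Qed.

Lemma bform_block m1 m2 n1 n2 (Mul : 'M[R]_(m1, n1)) (Mur : 'M[R]_(m1, n2))
    (Mdl : 'M[R]_(m2, n1)) (Mdr : 'M[R]_(m2, n2)) x1 x2 y1 y2 :
  bform (block_mx Mul Mur Mdl Mdr) (col_mx x1 x2) (col_mx y1 y2) =
  bform Mul x1 y1 + bform Mur x1 y2 + bform Mdl x2 y1 + bform Mdr x2 y2.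
Proof.
rewrite /bform tr_col_mx mul_row_block mul_row_col !mulmxDl !mxE; ring.
Qed.

Lemma qformD n (M : 'M[R]_n) x y : M^T = M ->
  qform M (x + y) = qform M x + 2 * bform M x y + qform M y.
Proof.
move=> MT; rewrite !qformE !(bformDl, bformDr) (bformC y x MT); ring.
Qed.

Lemma posdef_possemidef n (M : 'M[R]_n) : posdef M -> possemidef M.
Proof.
move=> [MT Mpos]; split => // x.
have [->|x0] := eqVneq x 0; first by rewrite /qform mulmx0 mxE.
exact/ltW/Mpos.
Qed.

Lemma mxlt_qform n (M N : 'M[R]_n) x : mxlt M N -> qform M x <= qform N x.
Proof.
move=> /posdef_possemidef[_ /(_ x)].
by rewrite !qformE bformDm bformNm subr_ge0.
Qed.

Lemma mxle_qform n (M N : 'M[R]_n) x : mxle M N -> qform M x <= qform N x.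
Proof. by move=> [_ /(_ x)]; rewrite !qformE bformDm bformNm subr_ge0. Qed.

Lemma bform1E n (x y : 'cV[R]_n) : bform 1%:M x y = \sum_i x i 0 * y i 0.
Proof.
by rewrite /bform mulmx1 mxE; apply: eq_bigr => i _; rewrite mxE.
Qed.

Lemma enorm_ge0 n (x : 'cV[R]_n) : 0 <= enorm x.
Proof. exact: sqrtr_ge0. Qed.

Lemma enorm_sqr n (x : 'cV[R]_n) : enorm x ^+ 2 = bform 1%:M x x.
Proof.
rewrite /enorm sqr_sqrtr; last by apply: sumr_ge0 => i _; exact: sqr_ge0.
by rewrite bform1E; apply: eq_bigr => i _; rewrite expr2.
Qed.

Lemma qform1_ge0 n (x : 'cV[R]_n) : 0 <= bform 1%:M x x.
Proof. by rewrite -enorm_sqr exprn_ge0// enorm_ge0. Qed.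

Lemma entry_le_enorm n (x : 'cV[R]_n) i : `|x i 0| <= enorm x.
Proof.
rewrite -(@ler_pXn2r _ 2) ?nnegrE ?enorm_ge0// enorm_sqr bform1E.
rewrite (bigD1 i)//= real_normK ?num_real// expr2 lerDl.
by apply: sumr_ge0 => j _; rewrite -expr2 sqr_ge0.
Qed.

Lemma enorm_eq0 n (x : 'cV[R]_n) : enorm x = 0 -> x = 0.
Proof.
move=> x0; apply/matrixP => i j; rewrite ord1 mxE.
by apply/eqP; rewrite -normr_le0 -x0; exact: entry_le_enorm.
Qed.

Lemma enormZ n a (x : 'cV[R]_n) : enorm (a *: x) = `|a| * enorm x.
Proof.
apply/eqP; rewrite -(@eqrXn2 _ 2) ?mulr_ge0 ?enorm_ge0//; apply/eqP.
rewrite exprMn !enorm_sqr bformZl bformZr real_normK ?num_real//; ring.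
Qed.

(** Expanding the square of |y|^2 x - <x, y> y gives |y|^2 times the difference of the two squared
    sides. *)
Lemma cauchy_schwarz n (x y : 'cV[R]_n) :
  `|bform 1%:M x y| <= enorm x * enorm y.
Proof.
have [y0|y0] := eqVneq (enorm y) 0.
  by rewrite y0 mulr0 (enorm_eq0 y0) /bform mulmx0 mxE normr0.
have ygt0 : 0 < enorm y by rewrite lt_neqAle eq_sym y0 enorm_ge0.
rewrite -(@ler_pXn2r _ 2) ?nnegrE ?mulr_ge0 ?enorm_ge0//.
rewrite exprMn real_normK ?num_real//.
have := qform1_ge0 (enorm y ^+ 2 *: x - bform 1%:M x y *: y).
rewrite !(bformDl, bformDr, bformNl, bformNr, bformZl, bformZr).
rewrite (bformC y x (trmx1 _ _)) -!enorm_sqr => hge0.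
rewrite -(@ler_pM2l _ (enorm y ^+ 2)) ?exprn_gt0//.
by rewrite -subr_ge0 (le_trans hge0)// le_eqVlt; apply/orP; left; apply/eqP; ring.
Qed.

Lemma enorm_le_sum n (x : 'cV[R]_n) : enorm x <= \sum_i `|x i 0|.
Proof.
rewrite -(@ler_pXn2r _ 2) ?nnegrE ?enorm_ge0 ?sumr_ge0//.
rewrite enorm_sqr bform1E [leRHS]expr2 mulr_suml ler_sum// => i _.
rewrite -expr2 -real_normK ?num_real// expr2 ler_wpM2l//.
by rewrite (bigD1 i)//= lerDl sumr_ge0.
Qed.

(** The supremum in [opnorm] is an upper bound only for a bounded set; the sum of all absolute
    entries serves as a crude bound. *)
Lemma enorm_mulmx_bounded m n (M : 'M[R]_(m, n)) :
  has_ubound [set enorm (M *m x) | x in [set x : 'cV[R]_n | enorm x <= 1]].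
Proof.
exists (\sum_i \sum_j `|M i j|) => _ [x /= x1 <-].
apply: (le_trans (enorm_le_sum _)); apply: ler_sum => i _.
rewrite mxE (le_trans (ler_norm_sum _ _ _))//; apply: ler_sum => j _.
by rewrite normrM ler_piMr// (le_trans (entry_le_enorm _ _)).
Qed.

Lemma opnorm_ge0 m n (M : 'M[R]_(m, n)) : 0 <= opnorm M.
Proof.
apply: (le_trans (enorm_ge0 (M *m 0))); apply: (ub_le_sup (enorm_mulmx_bounded M)).
by exists 0 => //=; rewrite -(scale0r 0) enormZ normr0 mul0r.
Qed.

Lemma enorm_mulmx m n (M : 'M[R]_(m, n)) x : enorm (M *m x) <= opnorm M * enorm x.
Proof.
have [x0|x0] := eqVneq (enorm x) 0.
  rewrite x0 mulr0 (enorm_eq0 x0) mulmx0 -(scale0r 0) enormZ normr0 mul0r//.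
have xgt0 : 0 < enorm x by rewrite lt_neqAle eq_sym x0 enorm_ge0.
rewrite -ler_pdivrMr//; apply: (ub_le_sup (enorm_mulmx_bounded M)).
exists ((enorm x)^-1 *: x) => /=.
  by rewrite enormZ ger0_norm ?invr_ge0 ?enorm_ge0// mulVf.
by rewrite -scalemxAr enormZ ger0_norm ?invr_ge0 ?enorm_ge0// mulrC.
Qed.

Lemma bform_opnorm n (M : 'M[R]_n) x y :
  `|bform M x y| <= opnorm M * (enorm x * enorm y).
Proof.
rewrite -[M]mul1mx bformMr mul1mx (le_trans (cauchy_schwarz _ _))//.
rewrite mulrCA ler_wpM2l ?enorm_ge0//; exact: enorm_mulmx.
Qed.

End BilinearForms.

(** * The matrix inequality as a dissipation inequality *)

Section Dissipation.
Context {R : realType} {n m : nat}.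

Lemma Psi_dissipation (zeta alpha gamma kappa h : R) (Q W A : 'M[R]_n)
    (D : 'M[R]_(m, n)) (L : 'M[R]_(n, m)) (P : 'M[R]_(n + 1))
    (phi e v w de : 'cV[R]_n) :
  P^T = P -> Q^T = Q -> W^T = W -> 0 < gamma ->
  mxlt (Psi zeta alpha gamma kappa h Q W A D L P) 0 ->
  enorm w ^+ 2 <= kappa ^+ 2 * enorm (phi + e) ^+ 2 ->
  de = (A - L *m D) *m e + L *m D *m v + w ->
  2 * bform P (extv phi) (extL L *m D *m (e - v))
  - 2 * (zeta - alpha) * qform P (extv phi)
  + 2 * bform Q e de + 2 * alpha * qform Q e
  + h ^+ 2 * expR (2 * alpha * h) * qform W de - pi ^+ 2 / 4 * qform W v <= 0.
Proof.
move=> PT QT WT gamma0 Psi0 wle ->.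
have := mxlt_qform (col_mx (col_mx (extv phi) e) (col_mx v w)) Psi0.
rewrite !qformE bform0m /Psi.
set c := h ^+ 2 * _; set U := A - L *m D; set LD := L *m D.
have -> : extL L *m D = extL LD :> 'M[R]_(n + 1, n).
  by rewrite /extL mul_col_mx mul0mx.
have -> : P *m extL L *m D = P *m extL LD.
  by rewrite -mulmxA /extL mul_col_mx mul0mx.
rewrite /sym_block4 /Phi !bform_block !bform_tr.
rewrite -!(mulmxA U^T) -!(mulmxA LD^T) !(bformDm, bformNm, bformZm, bform0m).
rewrite !(bformMl U^T) !(bformMl LD^T) !trmxK !bformMr.
have Om1 : bform Omega1 (extv phi) (extv phi) = bform 1%:M phi phi.
  by rewrite /Omega1 /extv bform_block !bform0m !addr0.
have Om2 : bform Omega2 (extv phi) e = bform 1%:M phi e.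
  by rewrite /Omega2 /extL /bform /extv tr_col_mx mul_row_col !mulmx0 addr0.
rewrite Om1 Om2.
move: wle; rewrite !enorm_sqr !(bformDl, bformDr) (bformC e phi (trmx1 _ _)).
rewrite !(bform_scalar (gamma * _)) !(bform_scalar gamma).
rewrite -/U -/LD mulmxBr !(bformDl, bformDr, bformNr).
rewrite (bformC (U *m e) e QT) (bformC (LD *m v) (U *m e) WT).
rewrite (bformC w (U *m e) WT) (bformC w (LD *m v) WT).
rewrite -(ler_pM2l gamma0) => h1 h2; lra.
Qed.
End Dissipation.

(** * Entrywise calculus and the matrix exponential *)

Section RealDerivatives.
Context {R : realType}.
Implicit Types (f g : R -> R) (x a b : R).

Lemma isd_cst x a : is_derive x 1 (fun=> a) 0.
Proof. exact: is_derive_cst. Qed.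

Lemma isd_add f g x a b : is_derive x 1 f a -> is_derive x 1 g b ->
  is_derive x 1 (fun r => f r + g r) (a + b).
Proof. exact: is_deriveD. Qed.

Lemma isd_mul f g x a b : is_derive x 1 f a -> is_derive x 1 g b ->
  is_derive x 1 (fun r => f r * g r) (a * g x + f x * b).
Proof.
move=> fa gb; apply: (is_derive_eq (is_deriveM fa gb)).
by rewrite addrC /GRing.scale/= (mulrC (g x)).
Qed.

Lemma isd_sum n (f : 'I_n -> R -> R) x (a : 'I_n -> R) :
  (forall i, is_derive x 1 (f i) (a i)) ->
  is_derive x 1 (fun r => \sum_i f i r) (\sum_i a i).
Proof.
move=> fa; rewrite (_ : (fun r => _) = \sum_i f i); first exact: is_derive_sum.
by apply/funext => r; rewrite fct_sumE.
Qed.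

Lemma isd_comp f g x a b : is_derive (g x) 1 f a -> is_derive x 1 g b ->
  is_derive x 1 (fun r => f (g r)) (a * b).
Proof. exact: is_derive1_comp. Qed.

Lemma isd_affine x a b : is_derive x 1 (fun r => a * r + b) a.
Proof.
apply: (is_derive_eq (isd_add (isd_mul (isd_cst x a) (is_derive_id x 1)) (isd_cst x b))).
by rewrite mul0r add0r mulr1 addr0.
Qed.

Lemma isd_scale x a : is_derive x 1 (fun r => a * r) a.
Proof.
apply: (is_derive_eq (isd_mul (isd_cst x a) (is_derive_id x 1))).
by rewrite mul0r add0r mulr1.
Qed.

Lemma isd_inv f x a : f x != 0 -> is_derive x 1 f a ->
  is_derive x 1 (fun r => (f r)^-1) (- (f x) ^- 2 * a).
Proof. by move=> fx fa; exact: is_deriveV. Qed.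

Lemma isd_continuous f x a : is_derive x 1 f a -> {for x, continuous f}.
Proof. by move=> [df _]; exact/differentiable_continuous/derivable1_diffP. Qed.

Lemma within_continuous_pt f (A : set R) :
  (forall x, A x -> {for x, continuous f}) -> {within A, continuous f}.
Proof.
move=> cf; apply/subspace_continuousP => x Ax.
by apply: cvg_within_filter; exact: cf.
Qed.

Lemma isd_le0_nonincr f (df : R -> R) a b : a <= b ->
  (forall x, a < x < b -> is_derive x 1 f (df x)) ->
  (forall x, a < x < b -> df x <= 0) ->
  (forall x, a <= x <= b -> {for x, continuous f}) -> f b <= f a.
Proof.
rewrite le_eqVlt => /predU1P[->//|ab] fdf df0 cf.
have cont : {within `[a, b], continuous f}.
  by apply: within_continuous_pt => x; rewrite /= in_itv/=; exact: cf.
have fd x : x \in `]a, b[ -> is_derive x 1 f (df x).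
  by rewrite in_itv/=; exact: fdf.
have [c] := MVT ab fd cont.
rewrite in_itv/= => /df0 dc fab.
by rewrite -subr_le0 fab mulr_le0_ge0// subr_ge0 ltW.
Qed.

Lemma isd_shift (f : R -> R) (t a d : R) :
  is_derive (t - a) 1 f d -> is_derive t 1 (fun r => f (r - a)) d.
Proof.
move=> fd; rewrite -[d]mulr1; apply: (isd_comp (f := f) (g := fun r => r - a)) => //.
by have := isd_affine t 1 (- a); under eq_fun do rewrite mul1r.
Qed.

End RealDerivatives.

(** * The weight of the sampling term *)

Section Gain.
Context {R : realType}.
Variables (alpha h : R).
Hypotheses (alpha0 : 0 < alpha) (h0 : 0 < h).

(* With [k t = (h pi / 2) cot (pi t / (2 h))] one has
   [k' = - pi ^ 2 / 4 - (k / h) ^ 2], the Riccati equation behind Wirtinger's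
   inequality; the exponential factor absorbs the decay rate [2 alpha]. *)
Definition gain (t : R) : R :=
  expR (2 * alpha * (h - t)) * (h * pi / 2) *
  (cos (pi / (2 * h) * t) / sin (pi / (2 * h) * t)).

Let w := pi / (2 * h).

Let w0 : 0 < w.
Proof. by rewrite divr_gt0 ?pi_gt0// mulr_gt0. Qed.

Let wh : w * h = pi / 2.
Proof. by rewrite /w; field; rewrite gt_eqF. Qed.

(** This is y <= tan y without the denominator: y cos y - sin y vanishes at 0 and has derivative - y
    sin y. *)
Lemma mul_cos_le_sin (y : R) : 0 <= y <= pi / 2 -> y * cos y <= sin y.
Proof.
move=> /andP[y0 ypi]; rewrite -subr_le0.
pose f (r : R) := r * cos r + - sin r.
have fd (x : R) : is_derive x 1 f (- (x * sin x)).
  apply: (is_derive_eq (isd_add (isd_mul (is_derive_id x 1) (is_derive_cos x))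
    (is_deriveN (is_derive_sin x)))) => /=.
  by rewrite mul1r mulrN; ring.
have -> : y * cos y - sin y = f y by [].
have f00 : f 0 = 0 by rewrite /f mul0r sin0 oppr0 addr0.
rewrite -f00; apply: (isd_le0_nonincr y0 (fun x _ => fd x)) => x /andP[x0 xy].
  rewrite oppr_le0 mulr_ge0 ?(ltW x0)// sin_ge0_pi// (ltW x0)/=.
  rewrite (le_trans (ltW xy))// (le_trans ypi)// ler_pdivrMr//.
  by rewrite ler_peMr ?pi_ge0// ler1n.
exact: isd_continuous (fd x).
Qed.

Let warg t : 0 < t <= h -> 0 < w * t <= pi / 2.
Proof.
by move=> /andP[t0 th]; rewrite mulr_gt0//= -wh ler_wpM2l// ltW.
Qed.

Let sin_w t : 0 < t <= h -> 0 < sin (w * t).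
Proof.
move=> /warg /andP[a b]; apply: sin_gt0_pi; rewrite a/=.
by rewrite (le_lt_trans b)// ltr_pdivrMr// ltr_pMr ?pi_gt0// ltr1n.
Qed.

Let cos_w t : 0 < t <= h -> 0 <= cos (w * t).
Proof.
move=> /warg /andP[a b]; apply: cos_ge0_pihalf; rewrite b andbT.
by rewrite (le_trans _ (ltW a))// oppr_le0 divr_ge0 ?pi_ge0.
Qed.

(** The frequency pi / (2 h) is chosen so that the cotangent first vanishes at t = h, the longest
    sampling interval allowed. *)
Lemma gain_ge0 t : 0 < t <= h -> 0 <= gain t.
Proof.
move=> th; rewrite /gain -/w !mulr_ge0 ?expR_ge0 ?pi_ge0 ?(ltW h0)//.
  exact: cos_w.
by rewrite invr_ge0 ltW// sin_w.
Qed.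

(** The pole at 0 is simple, because y cot y <= 1 for y = pi t / (2 h). *)
Lemma gain_le t : 0 < t <= h -> gain t * t <= expR (2 * alpha * h) * h ^+ 2.
Proof.
move=> th; have /andP[t0 tleh] := th; have s0 := sin_w th.
have wt0 : 0 < w * t by rewrite mulr_gt0.
rewrite /gain -/w.
have -> : expR (2 * alpha * (h - t)) * (h * pi / 2) * (cos (w * t) / sin (w * t)) * t
  = expR (2 * alpha * (h - t)) * h ^+ 2 * (w * t * cos (w * t) / sin (w * t)).
  have -> : h * pi / 2 = h ^+ 2 * w by rewrite /w; field; rewrite gt_eqF.
  by field; rewrite !gt_eqF.
rewrite -[leRHS]mulr1; apply: ler_pM.
- by rewrite mulr_ge0 ?expR_ge0 ?sqr_ge0.
- by rewrite mulr_ge0 ?invr_ge0 ?(ltW s0)// mulr_ge0 ?(ltW wt0)// cos_w.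
- rewrite ler_wpM2r ?sqr_ge0// ler_expR ler_wpM2l ?mulr_ge0 ?(ltW alpha0)//.
  by rewrite lerBlDr lerDl ltW.
rewrite ler_pdivrMr// mul1r; apply: mul_cos_le_sin; rewrite (ltW wt0)/=.
by have /andP[] := warg th.
Qed.

Definition dgain (t : R) : R :=
  - (2 * alpha) * gain t
  - expR (2 * alpha * (h - t)) * (pi ^+ 2 / 4) / sin (pi / (2 * h) * t) ^+ 2.

Lemma gain_derive t : 0 < t <= h -> is_derive t 1 gain (dgain t).
Proof.
move=> th; have s0 := sin_w th.
have d1 : is_derive t 1 (fun r => expR (2 * alpha * (h - r)))
    (expR (2 * alpha * (h - t)) * - (2 * alpha)).
  apply: (isd_comp (is_derive_expR _)).
  rewrite [X in is_derive _ _ X _](_ : _ = fun r => - (2 * alpha) * r + 2 * alpha * h).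
    exact: isd_affine.
  by apply/funext => r; ring.
have dw : is_derive t 1 (fun r => w * r) w by exact: isd_scale.
have dc := isd_comp (is_derive_cos (w * t)) dw.
have ds := isd_inv (lt0r_neq0 s0) (isd_comp (is_derive_sin (w * t)) dw).
apply: (is_derive_eq (isd_mul (isd_mul d1 (isd_cst _ _)) (isd_mul dc ds))).
rewrite /dgain /gain -/w mulr0 addr0.
have -> : pi ^+ 2 / 4 = (h * pi / 2) * w * (cos (w * t) ^+ 2 + sin (w * t) ^+ 2).
  by rewrite cos2Dsin2 /w; field; rewrite gt_eqF.
by field; rewrite gt_eqF.
Qed.

Lemma gain_riccati t : 0 < t <= h ->
  dgain t + 2 * alpha * gain t + gain t ^+ 2 / (h ^+ 2 * expR (2 * alpha * h))
    <= - (pi ^+ 2 / 4).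
Proof.
move=> th; have /andP[t0 tleh] := th; have s0 := sin_w th.
rewrite /dgain /gain -/w.
set s := sin _ in s0 *; set c := cos _.
have cs : c ^+ 2 = 1 - s ^+ 2 by rewrite /c cos2sin2.
have -> : expR (2 * alpha * (h - t)) = expR (2 * alpha * h) * expR (- (2 * alpha * t)).
  by rewrite -expRD; congr expR; ring.
set E := expR (2 * alpha * h); set F := expR _.
have E0 : 0 < E by exact: expR_gt0.
have F0 : 0 < F by exact: expR_gt0.
have F1 : F <= 1 by rewrite expR_le1 oppr_le0 !mulr_ge0 ?(ltW alpha0) ?(ltW t0).
have EF1 : 1 <= E * F.
  rewrite -expRD -expR0 ler_expR -mulrBr mulr_ge0 ?subr_ge0// mulr_ge0//.
  exact: ltW.
have pi0 : 0 < pi ^+ 2 / 4 :> R by rewrite divr_gt0 ?exprn_gt0 ?pi_gt0.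
(* The terms with factor [2 * alpha] cancel, and the rest is a multiple of pi^2 / 4. What remains is
   E F (1 - F c^2) >= s^2, which follows from F <= 1 <= E F; it is an equality when E = F = 1, that
   is, without the exponential weight. *)
have -> : - (2 * alpha) * (E * F * (h * pi / 2) * (c / s))
   - E * F * (pi ^+ 2 / 4) / s ^+ 2 + 2 * alpha * (E * F * (h * pi / 2) * (c / s))
   + (E * F * (h * pi / 2) * (c / s)) ^+ 2 / (h ^+ 2 * E)
  = (pi ^+ 2 / 4) * (- (E * F * (1 - F * c ^+ 2) / s ^+ 2)).
  by field; rewrite !gt_eqF.
rewrite -[leRHS]mulrN1 ler_wpM2l ?(ltW pi0)// lerN2.
rewrite ler_pdivlMr ?exprn_gt0// mul1r.
have c2 : 0 <= c ^+ 2 by rewrite sqr_ge0.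
have h1 : s ^+ 2 <= 1 - F * c ^+ 2.
  have : F * c ^+ 2 <= 1 * c ^+ 2 by rewrite ler_wpM2r.
  lra.
apply: (le_trans h1); apply: ler_peMl => //.
by rewrite (le_trans _ h1)// sqr_ge0.
Qed.

End Gain.

Section EntrywiseCalculus.
Context {R : realType}.

Lemma cvg_mx_entries (T : Type) (F : set_system T) (FF : Filter F) m n
    (M : T -> 'M[R]_(m, n)) (l : 'M[R]_(m, n)) :
  (M t @[t --> F] --> l) <-> (forall i j, M t i j @[t --> F] --> l i j).
Proof.
split=> [Ml i j|Ml]; apply/cvgrPdist_le => /= e e0.
  move/cvgrPdist_le : Ml => /(_ e e0); apply: filterS => t.
  rewrite {1}/Num.Def.normr/= mx_normrE => /bigmax_leP[_ /(_ (i, j) isT)].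
  by rewrite !mxE.
near=> t; rewrite {1}/Num.Def.normr/= mx_normrE.
apply/bigmax_leP; split=> [|[i j] _]; first exact: ltW.
rewrite !mxE/=; move: i j; near: t; apply: filter_forall => i.
by apply: filter_forall => j; move/cvgrPdist_le : (Ml i j) => /(_ e e0).
Unshelve. all: by end_near. Qed.

(** Working entrywise reduces products, transposes and quadratic forms to finite sums and products
    of scalar functions. *)
Definition mx_derive m n (t : R) (M : R -> 'M[R]_(m, n)) (dM : 'M[R]_(m, n)) :=
  forall i j, is_derive t 1 (fun r => M r i j) (dM i j).

Definition mx_continuous m n (t : R) (M : R -> 'M[R]_(m, n)) :=
  forall i j, {for t, continuous (fun r => M r i j)}.

Lemma mx_derive_continuous m n t (M : R -> 'M[R]_(m, n)) dM :
  mx_derive t M dM -> mx_continuous t M.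
Proof. by move=> d i j; exact: isd_continuous (d i j). Qed.

Lemma mx_derive_cst m n t (M : 'M[R]_(m, n)) : mx_derive t (fun=> M) 0.
Proof. by move=> i j; rewrite mxE; exact: isd_cst. Qed.

Lemma mx_derive_add m n t (M N : R -> 'M[R]_(m, n)) dM dN :
  mx_derive t M dM -> mx_derive t N dN ->
  mx_derive t (fun r => M r + N r) (dM + dN).
Proof.
move=> d1 d2 i j; rewrite mxE (_ : (fun r => _) = fun r => M r i j + N r i j).
  exact: isd_add.
by apply/funext => r; rewrite mxE.
Qed.

Lemma mx_derive_mul m n k t (M : R -> 'M[R]_(m, n)) (N : R -> 'M[R]_(n, k)) dM dN :
  mx_derive t M dM -> mx_derive t N dN ->
  mx_derive t (fun r => M r *m N r) (dM *m N t + M t *m dN).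
Proof.
move=> d1 d2 i j.
rewrite (_ : (fun r => _) = fun r => \sum_l M r i l * N r l j); last first.
  by apply/funext => r; rewrite mxE.
rewrite !mxE -big_split/=; apply: isd_sum => l; exact: isd_mul.
Qed.

Lemma mx_derive_tr m n t (M : R -> 'M[R]_(m, n)) dM :
  mx_derive t M dM -> mx_derive t (fun r => (M r)^T) dM^T.
Proof.
move=> d i j; rewrite mxE (_ : (fun r => _) = fun r => M r j i)//.
by apply/funext => r; rewrite mxE.
Qed.

Lemma is_derive_mx m n (t : R) (M : R -> 'M[R]_(m, n)) dM :
  is_derive t 1 M dM -> mx_derive t M dM.
Proof.
move=> [dv <-] i j; rewrite (derive_mx dv) mxE.
by split=> //; have /derivable_mxP := dv; exact.
Qed.

Lemma cvg_sum_ord (T : Type) (F : set_system T) (FF : Filter F) n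
    (f : 'I_n -> T -> R) (l : 'I_n -> R) :
  (forall i, f i t @[t --> F] --> l i) ->
  (\sum_i f i t) @[t --> F] --> \sum_i l i.
Proof.
elim: n f l => [|n IH] f l fl.
  rewrite big_ord0 (_ : (fun t => _) = fun=> 0); first exact: cvg_cst.
  by apply/funext => t; rewrite big_ord0.
rewrite big_ord_recr/= (_ : (fun t => _) =
    fun t => \sum_(i < n) f (widen_ord (leqnSn n) i) t + f ord_max t).
  by apply: cvgD => //; exact: IH.
by apply/funext => t; rewrite big_ord_recr.
Qed.

Lemma continuous_sum (t : R) n (f : 'I_n -> R -> R) :
  (forall i, {for t, continuous (f i)}) ->
  {for t, continuous (fun r => \sum_i f i r)}.
Proof. by move=> cf; apply: cvg_sum_ord => i; exact: cf. Qed.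

Lemma mx_continuous_cst m n t (M : 'M[R]_(m, n)) : mx_continuous t (fun=> M).
Proof. by move=> i j; exact: cvg_cst. Qed.

Lemma mx_continuous_add m n t (M N : R -> 'M[R]_(m, n)) :
  mx_continuous t M -> mx_continuous t N -> mx_continuous t (fun r => M r + N r).
Proof.
move=> c1 c2 i j; rewrite (_ : (fun r => _) = fun r => M r i j + N r i j).
  by apply: cvgD; [exact: c1|exact: c2].
by apply/funext => r; rewrite mxE.
Qed.

Lemma mx_continuous_opp m n t (M : R -> 'M[R]_(m, n)) :
  mx_continuous t M -> mx_continuous t (fun r => - M r).
Proof.
move=> c1 i j; rewrite (_ : (fun r => _) = fun r => - M r i j).
  by apply: cvgN; exact: c1.
by apply/funext => r; rewrite mxE.
Qed.

Lemma mx_continuous_mul m n k t (M : R -> 'M[R]_(m, n)) (N : R -> 'M[R]_(n, k)) :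
  mx_continuous t M -> mx_continuous t N ->
  mx_continuous t (fun r => M r *m N r).
Proof.
move=> c1 c2 i j.
rewrite (_ : (fun r => _) = fun r => \sum_l M r i l * N r l j).
  by apply: continuous_sum => l; apply: cvgM; [exact: c1|exact: c2].
by apply/funext => r; rewrite mxE.
Qed.

Lemma mx_continuous_tr m n t (M : R -> 'M[R]_(m, n)) :
  mx_continuous t M -> mx_continuous t (fun r => (M r)^T).
Proof.
move=> c i j; rewrite (_ : (fun r => _) = fun r => M r j i); first exact: c.
by apply/funext => r; rewrite mxE.
Qed.

Lemma qform_derive n t (M : R -> 'M[R]_n) (x : R -> 'cV[R]_n) dM dx :
  (M t)^T = M t -> mx_derive t M dM -> mx_derive t x dx ->
  is_derive t 1 (fun r => qform (M r) (x r))
    (qform dM (x t) + 2 * bform (M t) (x t) dx).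
Proof.
move=> MT dm dxt.
apply: (is_derive_eq (mx_derive_mul (mx_derive_mul (mx_derive_tr dxt) dm) dxt 0 0)).
rewrite mulmxDl mxE [X in X + _]mxE.
rewrite -[X in X + _ + _]/(bform (M t) dx (x t)) (bformC _ _ MT) qformE /bform.
ring.
Qed.

Lemma qform_continuous n t (M : R -> 'M[R]_n) (x : R -> 'cV[R]_n) :
  mx_continuous t M -> mx_continuous t x ->
  {for t, continuous (fun r => qform (M r) (x r))}.
Proof.
move=> cm cx; apply: (mx_continuous_mul (mx_continuous_mul _ cm) cx).
exact: mx_continuous_tr.
Qed.

Lemma mx_derive_opp m n t (M : R -> 'M[R]_(m, n)) dM :
  mx_derive t M dM -> mx_derive t (fun r => - M r) (- dM).
Proof.
move=> d i j; rewrite mxE (_ : (fun r => _) = - (fun r => M r i j)).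
  exact: is_deriveN.
by apply/funext => r; rewrite mxE.
Qed.

Lemma mx_derive_shift m n (t a : R) (M : R -> 'M[R]_(m, n)) dM :
  mx_derive (t - a) M dM -> mx_derive t (fun r => M (r - a)) dM.
Proof. by move=> d i j; exact: isd_shift (d i j). Qed.

Lemma mx_continuous_shift m n (t a : R) (M : R -> 'M[R]_(m, n)) :
  mx_continuous (t - a) M -> mx_continuous t (fun r => M (r - a)).
Proof.
move=> c i j; apply: (@continuous_comp _ _ _ (fun r => r - a) (fun r => M r i j)).
  by apply: cvgB; [exact: cvg_id|exact: cvg_cst].
exact: c.
Qed.

(** Each entry of f(x r) - f(x t) is at most kappa times the sum of the entrywise distances of x r
    and x t, a continuous function of r that vanishes at t. *)
Lemma lipschitz_mx_continuous n (kappa : R) (f : 'cV[R]_n -> 'cV[R]_n)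
    (x : R -> 'cV[R]_n) t : 0 <= kappa ->
  (forall u v, enorm (f u - f v) <= kappa * enorm (u - v)) ->
  mx_continuous t x -> mx_continuous t (fun r => f (x r)).
Proof.
move=> kappa0 flip cx i j; rewrite ord1.
have c0 : {for t, continuous (fun r => kappa * \sum_i `|x t i 0 - x r i 0|)}.
  apply: cvgM; first exact: cvg_cst.
  apply: continuous_sum => k; apply: cvg_norm; apply: cvgB; first exact: cvg_cst.
  exact: cx.
have z : kappa * \sum_i `|x t i 0 - x t i 0| = 0.
  by rewrite big1 ?mulr0// => k _; rewrite subrr normr0.
have {}c0 : kappa * (\sum_i `|x t i 0 - x r i 0|) @[r --> t] --> (0 : R).
  by rewrite -[X in _ --> X]z; exact: c0.
apply/cvgrPdist_lt => e e0.
move/cvgrPdist_lt : c0 => /(_ e e0); apply: filterS => r.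
rewrite sub0r normrN; apply: le_lt_trans; rewrite [leRHS]ger0_norm ?mulr_ge0 ?sumr_ge0//.
have := entry_le_enorm (f (x t) - f (x r)) i; rewrite !mxE => /le_trans; apply.
rewrite (le_trans (flip _ _))// ler_wpM2l// (le_trans (enorm_le_sum _))//.
by apply: ler_sum => k _; rewrite !mxE.
Qed.

End EntrywiseCalculus.

Section MatrixExponential.
Context {R : realType}.

(** Domination by an exponential series ensures convergence everywhere and survives formal
    differentiation. Both are needed: termwise differentiation is applied below with convergence of
    a series and of its first two formal derivatives. *)
Let exp_bounded (c : R^nat) := exists M K : R,
  forall k, 0 <= K /\ `|c k| <= M * (K ^+ k / k`!%:R).

Let exp_bounded_cvg c (x : R) : exp_bounded c -> cvgn (pseries c x).
Proof.
move=> [M [K cMK]]; apply: normed_cvg.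
apply: (@series_le_cvg _ _ (M *: exp_coeff (K * `|x|))) => [k|k|k|].
- exact: normr_ge0.
- have [K0 /(le_trans (normr_ge0 _)) M0] := cMK 0%N.
  rewrite expr0 fact0 divr1 mulr1 in M0.
  by rewrite /GRing.scale/= mulr_ge0// exp_coeff_ge0// mulr_ge0.
- have [K0 cM] := cMK k.
  rewrite /= normrM normrX (le_trans (ler_wpM2r _ cM)) ?exprn_ge0//.
  have -> : (M *: exp_coeff (K * `|x|)) k = M * ((K * `|x|) ^+ k / k`!%:R) by [].
  by rewrite exprMn le_eqVlt; apply/orP; left; apply/eqP; ring.
- exact/is_cvg_seriesZ/is_cvg_series_exp_coeff.
Qed.

Let exp_bounded_diffs c : exp_bounded c -> exp_bounded (pseries_diffs c).
Proof.
move=> [M [K cMK]]; exists (M * K), K => k; have [K0 cM] := cMK k.+1.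
split=> //; rewrite /pseries_diffs normrM normr_nat.
rewrite (le_trans (ler_wpM2l _ cM))// factS natrM exprS.
rewrite le_eqVlt; apply/orP; left; apply/eqP; field.
by rewrite pnatr_eq0 -lt0n fact_gt0 addrC natr1 pnatr_eq0.
Qed.

Let coef n (A : 'M[R]_n) i j (k : nat) : R := (k`!%:R)^-1 * (A ^+ k) i j.

Lemma expr_entry_le n (A : 'M[R]_n) i j k :
  `|(A ^+ k) i j| <= (\sum_i \sum_j `|A i j|) ^+ k.
Proof.
elim: k i j => [|k IH] i j.
  by rewrite !expr0 mxE; case: eqP => _; rewrite ?normr1 ?normr0.
rewrite !exprS mxE (le_trans (ler_norm_sum _ _ _))//.
apply: (@le_trans _ _ (\sum_l `|A i l| * (\sum_i \sum_j `|A i j|) ^+ k)).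
  by apply: ler_sum => l _; rewrite normrM ler_wpM2l.
rewrite -mulr_suml ler_wpM2r ?exprn_ge0 ?sumr_ge0//.
  by move=> ? _; rewrite sumr_ge0.
rewrite [leRHS](bigD1 i)//= lerDl sumr_ge0// => ? _; exact: sumr_ge0.
Qed.

Let coef_bounded n (A : 'M[R]_n) i j : exp_bounded (coef A i j).
Proof.
exists 1, (\sum_i \sum_j `|A i j|) => k; split.
  by rewrite sumr_ge0// => ? _; exact: sumr_ge0.
rewrite mul1r normrM ger0_norm ?invr_ge0// mulrC ler_wpM2r ?invr_ge0//.
exact: expr_entry_le.
Qed.

Lemma expr_scalemx n (A : 'M[R]_n) (t : R) k : (t *: A) ^+ k = t ^+ k *: A ^+ k.
Proof.
elim: k => [|k IH]; first by rewrite !expr0 scale1r.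
by rewrite !exprS IH -!mulmxE -scalemxAl -scalemxAr scalerA.
Qed.

Lemma expmx_entry n (A : 'M[R]_n) (t : R) i j :
  expmx (t *: A) i j = limn (pseries (coef A i j) t).
Proof.
pose E := \matrix_(i, j) limn (pseries (coef A i j) t).
have -> : limn (pseries (coef A i j) t) = E i j by rewrite mxE.
suff -> : expmx (t *: A) = E by [].
apply/cvg_lim => //; apply/cvg_mx_entries => i' j'; rewrite mxE.
rewrite (_ : (fun k => _) = pseries (coef A i' j') t).
  exact/exp_bounded_cvg/coef_bounded.
apply/funext => k; rewrite /pseries /series/= summxE; apply: eq_bigr => q _.
rewrite mxE expr_scalemx mxE /coef; ring.
Qed.

Lemma expmx_tr n (A : 'M[R]_n) (t : R) : expmx (t *: A^T) = (expmx (t *: A))^T.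
Proof.
apply/matrixP => i j; rewrite mxE !expmx_entry; congr (limn (pseries _ t)).
apply/funext => k; rewrite /coef; congr (_ * _).
suff -> : A^T ^+ k = (A ^+ k)^T by rewrite mxE.
elim: k => [|k IH]; first by rewrite !expr0 trmx1.
by rewrite exprS exprSr IH -!mulmxE trmx_mul.
Qed.

Lemma expmx0 n (A : 'M[R]_n) : expmx ((0 : R) *: A) = 1%:M.
Proof.
apply/matrixP => i j; rewrite expmx_entry.
apply/cvg_lim => //; apply: cvg_near_cst.
(* The empty partial sum is 0; the identity matrix appears only once the term of index 0 is
   included. *)
near=> k; have k0 : (0 < k)%N by near: k; exact: nbhs_infty_gt.
rewrite /pseries /series/= -(prednK k0) big_nat_recl// big1.
  by rewrite /coef fact0 invr1 mul1r !expr0 mulr1 addr0.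
by move=> q _; rewrite expr0n mulr0.
Unshelve. all: by end_near. Qed.

Lemma expmx_derive n (A : 'M[R]_n) (t : R) :
  mx_derive t (fun r => expmx (r *: A)) (A *m expmx (t *: A)).
Proof.
move=> i j.
rewrite (_ : (fun r => _) = fun r => limn (pseries (coef A i j) r)); last first.
  by apply/funext => r; rewrite expmx_entry.
have bc := coef_bounded A i j.
have cvgc B x : exp_bounded B -> cvgn (pseries B x) by exact: exp_bounded_cvg.
have tlt : `|t| < `|(`|t| + 1)%R|.
  by rewrite [ltRHS]ger0_norm ?addr_ge0// ltrDl.
have := @pseries_snd_diffs R (coef A i j) (`|t| + 1) t (cvgc _ _ bc)
  (cvgc _ _ (exp_bounded_diffs bc))
  (cvgc _ _ (exp_bounded_diffs (exp_bounded_diffs bc))) tlt.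
suff -> : limn (pseries (pseries_diffs (coef A i j)) t) =
    (A *m expmx (t *: A)) i j by [].
apply/cvg_lim => //; rewrite mxE.
rewrite (_ : pseries _ t = fun k => \sum_l A i l * pseries (coef A l j) t k).
  apply: cvg_sum_ord => l; apply: cvgM; first exact: cvg_cst.
  rewrite expmx_entry.
  exact/cvgc/coef_bounded.
apply/funext => k; rewrite /pseries /series/=.
(* The coefficient (q+1) / (q+1)! times A^(q+1) is A times A^q / q!, with the extra factor on the
   left, where the claimed derivative has it. *)
under eq_bigr => q _.
  rewrite /pseries_diffs /coef exprS mxE factS natrM invfM.
  rewrite mulrA mulrA mulfV ?pnatr_eq0// mul1r mulr_sumr mulr_suml.
  over.
rewrite exchange_big; apply: eq_bigr => l _.
by rewrite mulr_sumr; apply: eq_bigr => q _; rewrite /coef; ring.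
Qed.

End MatrixExponential.

Section Clamp.
Context {R : realType}.
Implicit Types a b t u : R.

(** [P] is specified on [[0, T]] only. Composed with [clamp 0 T] it becomes continuous on the whole
    line and stays at [P T] after the dwell time. *)
Definition clamp (a b t : R) : R := Num.max a (Num.min t b).

Lemma clamp_id a b t : a <= t <= b -> clamp a b t = t.
Proof. by move=> /andP[at_ tb]; rewrite /clamp min_l// max_r. Qed.

Lemma clamp_ge a b t : a <= b <= t -> clamp a b t = b.
Proof. by move=> /andP[ab bt]; rewrite /clamp min_r// max_r. Qed.

Lemma clamp_itv a b t : a <= b -> a <= clamp a b t <= b.
Proof.
by move=> ab; rewrite /clamp le_max lexx/= ge_max ab/= ge_min lexx orbT.
Qed.

Lemma dist_max_le a t u : `|Num.max a t - Num.max a u| <= `|t - u|.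
Proof.
rewrite ler_norml; have := ler_norm (t - u); have := ler_norm (u - t).
rewrite (distrC u); case: (leP a t) => ?; case: (leP a u) => ? ? ?;
  apply/andP; split; lra.
Qed.

Lemma dist_min_le b t u : `|Num.min t b - Num.min u b| <= `|t - u|.
Proof.
rewrite ler_norml; have := ler_norm (t - u); have := ler_norm (u - t).
rewrite (distrC u); case: (leP t b) => ?; case: (leP u b) => ? ? ?;
  apply/andP; split; lra.
Qed.

Lemma clamp_dist a b t u : `|clamp a b t - clamp a b u| <= `|t - u|.
Proof. exact: le_trans (dist_max_le _ _ _) (dist_min_le _ _ _). Qed.

Lemma clamp_continuous (V : topologicalType) a b (f : R -> V) t : a <= b ->
  {within `[a, b], continuous f} -> {for t, continuous (fun r => f (clamp a b r))}.
Proof.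
move=> ab /subspace_continuousP/(_ (clamp a b t)) cf.
have cI u : `[a, b]%classic (clamp a b u).
  by rewrite /= in_itv/=; exact: clamp_itv.
have cc : {for t, continuous (clamp a b)}.
  apply/cvgrPdist_lt => e e0; apply/nbhs_ballP; exists e => //= u.
  exact: le_lt_trans (clamp_dist _ _ _ _).
move=> U /(cf (cI t)) fU.
have H : \forall u \near t, `[a, b]%classic (clamp a b u) -> U (f (clamp a b u)).
  exact: cc _ fU.
by apply: filterS H => u; apply; exact: cI.
Qed.

(** Near an interior point the restriction to [D] is void; the substitution s = h + t then passes to
    the increment form of the directional derivative. *)
Lemma is_derive_within_entry m n (D : set R) (t : R) (F : R -> 'M[R]_(m, n)) dF :
  nbhs t D -> is_derive_within D t F dF -> mx_derive t F dF.
Proof.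
move=> Dt /cvg_mx_entries FdF i j.
suff H : (fun h : R => h^-1 *: (F (h *: 1 + t) i j - F t i j)) @ 0^' --> dF i j.
  split; first by apply/cvg_ex; exists (dF i j).
  exact/cvg_lim.
move/(_ i j)/cvgrPdist_le : FdF => Fd; apply/cvgrPdist_le => /= e /Fd.
rewrite /within/= /dnbhs/= => H.
have : \forall s \near t, s != t -> `|dF i j - ((s - t)^-1 *: (F s - F t)) i j| <= e.
  by apply: filterS2 Dt H => s Ds + st; apply.
rewrite (near_shift 0) subr0; apply: filterS => h /= H1 h0.
have := H1; rewrite -subr_eq0 addrK => /(_ h0).
by rewrite !mxE /GRing.scale/= mulr1.
Qed.

End Clamp.

(** * The differential Lyapunov equation *)

Section LyapunovMatrix.
Context {R : realType} {n p : nat}.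
Variables (zeta T : R) (A : 'M[R]_n) (b : 'cV[R]_n) (C : 'M[R]_(p, n)).
Variables (X : 'M[R]_n) (P : R -> 'M[R]_(n + 1)).
Hypothesis T0 : 0 < T.
Hypothesis P_sol : is_Pbar zeta T A b C X P.

Let Pc t := P (clamp 0 T t).

Lemma Pbar_continuous t : mx_continuous t (fun r => P (clamp 0 T r)).
Proof.
have [cP _ _] := P_sol.
by apply/cvg_mx_entries; exact: (clamp_continuous (ltW T0) cP).
Qed.

(** Clamping creates corners at 0 and T in general, so only interior points are treated; the
    comparison argument asks for derivatives only on short open intervals to the right of each
    time. *)
Lemma Pbar_derive t : 0 < t < T -> mx_derive t (fun r => P (clamp 0 T r))
  (- ((extA A b)^T *m P t + P t *m extA A b
      + (extC C)^T *m extC C + (2 * zeta) *: P t)).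
Proof.
move=> /andP[t0 tT]; have [_ _ /(_ t)] := P_sol.
rewrite (ltW t0) tT => /(_ isT) dP i j.
have near_in : \forall s \near t, 0 <= s <= T.
  near=> s; apply/andP; split; apply: ltW; near: s.
    exact: lt_nbhsr.
  exact: lt_nbhsl.
have T_t : nbhs t `[0, T]%classic.
  by apply: filterS near_in => s; rewrite /= in_itv.
apply: (near_eq_is_derive _ (is_derive_within_entry T_t dP i j)).
by apply: filterS near_in => s sI; rewrite clamp_id.
Unshelve. all: by end_near. Qed.

Lemma Pbar_derive_ge t : T < t -> mx_derive t (fun r => P (clamp 0 T r)) 0.
Proof.
move=> Tt i j; rewrite mxE; apply: (near_eq_is_derive (f := fun=> P T i j)).
  near=> s; rewrite clamp_ge//; apply/andP; split; first exact: ltW.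
  by apply: ltW; near: s; exact: lt_nbhsr.
Unshelve. all: by end_near. Qed.

(* [exp(B^T t) P(t) exp(B t)] with [B = A + zeta I] has derivative
   [- exp(B^T t) C^T C exp(B t)]. *)
Lemma Pbar_initial : Y1 zeta T A b X + Y2 zeta T A b C = P 0.
Proof.
have [_ PT _] := P_sol.
pose B := extA A b + zeta%:M.
have BT : (extA A b)^T + zeta%:M = B^T by rewrite linearD/= tr_scalar_mx.
pose CC := (extC C)^T *m extC C.
pose E t : 'M[R]_(n + 1) := expmx (t *: B).
pose N t := (E t)^T *m Pc t *m E t.
pose dN t := (E t)^T *m CC *m E t.
have dE t : mx_derive t E (B *m E t) by exact: expmx_derive.
have cE t : mx_continuous t E by exact: mx_derive_continuous (dE t).
have cN t : mx_continuous t N.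
  apply: mx_continuous_mul => //; apply: mx_continuous_mul.
    exact: mx_continuous_tr.
  exact: Pbar_continuous.
have dNP t : 0 < t < T -> mx_derive t N (- dN t).
  move=> tT; have dP := Pbar_derive tT.
  have /andP[/ltW t0 /ltW tleT] := tT.
  have := mx_derive_mul (mx_derive_mul (mx_derive_tr (dE t)) dP) (dE t).
  rewrite /N /Pc clamp_id ?t0//; congr mx_derive.
  (* The shift by [zeta%:M] contributes [zeta *: P t] on each side, which cancels the term
     [(2 * zeta) *: P t] of the equation. *)
  have sum0 : B^T *m P t + - ((extA A b)^T *m P t + P t *m extA A b + CC
      + (2 * zeta) *: P t) + P t *m B = - CC.
    rewrite -BT mulmxDl mulmxDr mul_scalar_mx mul_mx_scalar.
    set U := _ *m P t; set V := P t *m _.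
    by apply/matrixP => i j; rewrite !mxE; ring.
  have distr (M B' P' dP' F : 'M[R]_(n + 1)) :
      (M *m B' *m P' + M *m dP') *m F + M *m P' *m (B *m F) =
      M *m (B' *m P' + dP' + P' *m B) *m F.
    by rewrite !mulmxA -!mulmxDl !mulmxDr !mulmxA.
  by rewrite /dN -mulNmx -mulmxN -sum0 trmx_mul -distr.
have EN i j : \int[lebesgue_measure]_(t in `[0, T]) dN t i j = N 0 i j - N T i j.
  have cdN t : mx_continuous t dN.
    apply: mx_continuous_mul => //; apply: mx_continuous_mul.
      exact: mx_continuous_tr.
    exact: mx_continuous_cst.
  (* This form of the fundamental theorem takes derivatives inside the interval and one-sided limits
     at its ends, so the corners of the clamped [P] do no harm. *)
  rewrite /Rintegral (@continuous_FTC2 _ _ (fun t => - N t i j)) //=.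
  - by rewrite opprK addrC.
  - by apply: within_continuous_pt => t _; exact: cdN.
  - split.
    + move=> t; rewrite in_itv/= => /dNP /(_ i j) d.
      by apply: derivableN; exact: ex_derive.
    + by apply: cvgN; apply: cvg_at_right_filter; exact: cN.
    + by apply: cvgN; apply: cvg_at_left_filter; exact: cN.
  - move=> t; rewrite in_itv/= => /dNP /(_ i j) d.
    rewrite derive1E; have := is_deriveN d; rewrite mxE opprK => d'.
    exact: derive_val.
have N0 : N 0 = P 0.
  rewrite /N /Pc /E expmx0 trmx1 mul1mx mulmx1 clamp_id// lexx; exact: ltW.
have NT : N T = Y1 zeta T A b X.
  by rewrite /N /Pc /Y1 /E BT expmx_tr clamp_id ?lexx ?(ltW T0)// PT.
apply/matrixP => i j; rewrite [LHS]mxE [X in _ + X]mxE -NT -N0.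
have := EN i j.
rewrite [X in X = _](_ : _ = \int[lebesgue_measure]_(tau in `[0, T])
    (expmx (tau *: ((extA A b)^T + zeta%:M)) *m (extC C)^T *m extC C
       *m expmx (tau *: (extA A b + zeta%:M))) i j); last first.
  by apply: eq_Rintegral => t _; rewrite /dN /CC BT expmx_tr !mulmxA.
by move=> ->; rewrite addrC subrK.
Qed.

End LyapunovMatrix.

(** * Comparison and averaging *)

Section JumpComparison.
Context {R : realType}.

Lemma jump_nonincr (U : R -> R) :
  (forall t, 0 <= t -> exists2 d, 0 < d & forall s, t <= s < t + d -> U s <= U t) ->
  (forall t, 0 < t -> exists G d, [/\ 0 < d,
     forall s, t - d < s < t -> U s = G s, {for t, continuous G} & U t <= G t]) ->
  forall t, 0 <= t -> U t <= U 0.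
Proof.
move=> right left t1 t10; rewrite leNgt; apply/negP => Ut1.
pose S := [set t | 0 <= t <= t1 /\ forall s, 0 <= s <= t -> U s <= U 0].
have S0 : S 0.
  by split=> [|s]; [rewrite lexx | rewrite -eq_le => /eqP <-].
have ubS : ubound S t1 by move=> t [/andP[]].
have supS : has_sup S by split; [exists 0 | exists t1].
pose tau := sup S.
have tau0 : 0 <= tau by exact: (ub_le_sup (proj2 supS) S0).
have taut1 : tau <= t1 by exact: ge_sup (proj1 supS) ubS.
have below s : 0 <= s < tau -> U s <= U 0.
  move=> /andP[s0 stau]; have [t [_ tS] st] := sup_gt (proj1 supS) stau.
  by apply: tS; rewrite s0 ltW.
have Utau : U tau <= U 0.
  move: tau0; rewrite le_eqVlt => /predU1P[<-//|tau0].
  have [G [d [d0 UG cG UtG]]] := left _ tau0.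
  apply: (le_trans UtG); rewrite leNgt; apply/negP => GU.
  have /nbhs_ballP[e /= e0 he] : \forall s \near tau, U 0 < G s.
    by move/cvgr_gt : cG; apply.
  (* The point tau - r must lie in the ball where G exceeds U(0), in the range where U = G, and at a
     positive time; halving makes all three strict. *)
  pose r := Num.min e (Num.min d tau) / 2.
  have r0 : 0 < r by rewrite divr_gt0// !lt_min e0 d0 tau0.
  have [re rd rt] : [/\ r < e, r < d & r < tau].
    have m0 : 0 < Num.min e (Num.min d tau) by rewrite !lt_min e0 d0 tau0.
    have rm : r < Num.min e (Num.min d tau).
      by rewrite /r ltr_pdivrMr// mulr2n mulrDr mulr1 ltrDl.
    by move: rm; rewrite !lt_min => /and3P[].
  have : U 0 < G (tau - r).
    apply: he; rewrite /ball/= opprB addrC subrK gtr0_norm//.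
  rewrite -UG; last by rewrite ltrD2l ltrN2 rd/= ltrBlDr ltrDl.
  by rewrite ltNge below// subr_ge0 (ltW rt)/= ltrBlDr ltrDl.
have {}taut1 : tau < t1.
  rewrite lt_neqAle taut1 andbT; apply/eqP => taut.
  by move: Ut1; rewrite -taut ltNge Utau.
have [d d0 Ud] := right _ tau0.
pose t2 := Num.min (tau + d / 2) t1.
have tt2 : tau < t2 by rewrite lt_min taut1 ltrDl divr_gt0.
have St2 : S t2.
  split; first by rewrite (le_trans tau0 (ltW tt2))/= ge_min lexx orbT.
  move=> s /andP[s0 st2]; have [stau|taus] := ltP s tau.
    by apply: below; rewrite s0.
  rewrite (le_trans _ Utau)// Ud// taus/=.
  rewrite (le_lt_trans st2)// gt_min ltrD2l ltr_pdivrMr//.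
  by rewrite mulr2n mulrDr mulr1 ltrDl d0.
have := ub_le_sup (proj2 supS) St2.
by rewrite leNgt tt2.
Qed.

(** The integrating factor exp(a s) turns the differential inequality into monotonicity of exp(a s)
    (V(s) - c), and being positive it preserves downward jumps. *)
Lemma jump_comparison (V : R -> R) (a c : R) :
  (forall t, 0 <= t -> exists (F dF : R -> R) d, [/\ 0 < d,
     forall s, t <= s < t + d -> V s = F s,
     forall s, t < s < t + d -> is_derive s 1 F (dF s),
     forall s, t < s < t + d -> dF s + a * F s <= a * c
     & {for t, continuous F}]) ->
  (forall t, 0 < t -> exists F d, [/\ 0 < d,
     forall s, t - d < s < t -> V s = F s, {for t, continuous F} & V t <= F t]) ->
  forall t, 0 <= t -> V t <= c + (V 0 - c) * expR (- (a * t)).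
Proof.
move=> right left t t0.
pose w (F : R -> R) s := expR (a * s) * (F s - c).
have dexp (s : R) : is_derive s 1 (fun r => expR (a * r)) (expR (a * s) * a).
  exact: (isd_comp (is_derive_expR _) (isd_scale s a)).
have cw F s : {for s, continuous F} -> {for s, continuous (w F)}.
  move=> cF; apply: cvgM; first exact: isd_continuous (dexp s).
  by apply: cvgB => //; exact: cvg_cst.
suff : w V t <= w V 0.
  rewrite /w mulr0 expR0 mul1r => H; rewrite -lerBlDl expRN.
  by rewrite ler_pdivlMr ?expR_gt0// mulrC.
apply: jump_nonincr t0 => {}t t0.
  have [F [dF [d [d0 VF FdF dFle cF]]]] := right _ t0; exists d => // s /andP[ts sd].
  have -> : w V s = w F s by rewrite /w VF// ts.
  have -> : w V t = w F t by rewrite /w VF// lexx ltrDl.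
  have dw (r : R) : t < r < t + d ->
      is_derive r 1 (w F) (expR (a * r) * (dF r + a * F r - a * c)).
    move=> /FdF dFr; apply: (is_derive_eq
      (isd_mul (dexp r) (isd_add dFr (isd_cst r (- c))))).
    by rewrite addr0; ring.
  apply: (isd_le0_nonincr ts) => [r /andP[tr rs]|r /andP[tr rs]|r /andP[tr rs]].
  - by apply: dw; rewrite tr (lt_trans rs).
  - by rewrite mulr_ge0_le0 ?expR_ge0// subr_le0 dFle// tr (lt_trans rs).
  - move: tr; rewrite le_eqVlt => /predU1P[<-|tr]; first exact: cw.
    by apply: isd_continuous (dw r _); rewrite tr (le_lt_trans rs).
have [F [d [d0 VF cF VtF]]] := left _ t0; exists (w F), d; split => //.
- by move=> s sd; rewrite /w VF.
- exact: cw.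
- by rewrite /w ler_wpM2l ?expR_ge0// lerB.
Qed.

End JumpComparison.

Section Asymptotics.
Context {R : realType}.

(** A remainder [K / t] is the common form for all three limits: it dominates the exponential decay
    of the state and is what averaging leaves of the transient in the cost. *)
Lemma limsup_infty_le (g : R -> R) (B K : R) :
  (forall t, 0 < t -> g t <= B + K / t) -> (limsup_infty g <= B%:E)%E.
Proof.
move=> gBK; apply/lee_addgt0Pr => e e0.
(* The added 1 keeps [t0] positive when [K] is 0. *)
pose t0 := (`|K| + 1) / e.
have t00 : 0 < t0 by rewrite divr_gt0// ltr_wpDl.
apply: (@le_trans _ _ (ereal_sup ((fun t => (g t)%:E) @` [set t | t0 < t]))).
  apply: ereal_inf_lbound; exists [set t | t0 < t] => //.
  by exists t0; split => //; exact: num_real.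
apply: ge_ereal_sup => _ [t /= t0t <-].
have tgt0 : 0 < t by exact: lt_trans t0t.
rewrite -EFinD lee_fin (le_trans (gBK _ tgt0))// lerD2l ler_pdivrMr//.
move: t0t; rewrite /t0 ltr_pdivrMr// mulrC => /ltW; apply: le_trans.
by rewrite (le_trans (ler_norm _))// lerDl.
Qed.

Lemma expRN_le_inv (a t : R) : 0 < a -> 0 < t -> expR (- (a * t)) <= a^-1 / t.
Proof.
move=> a0 t0; rewrite expRN -invfM lef_pV2 ?posrE ?expR_gt0 ?mulr_gt0//.
by rewrite mulrC (le_trans _ (expR_ge1Dx _))// mulrC lerDr.
Qed.

Lemma Rintegral_expRN_le (a t : R) : 0 < a -> 0 < t ->
  \int[lebesgue_measure]_(r in `[0, t]) expR (- (a * r)) <= a^-1.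
Proof.
move=> a0 t0.
pose F (r : R) := - a^-1 * expR (- a * r).
have dF (r : R) : is_derive r 1 F (expR (- (a * r))).
  apply: (is_derive_eq (isd_mul (isd_cst r (- a^-1))
    (isd_comp (is_derive_expR _) (isd_scale r (- a))))).
  by rewrite mul0r add0r !mulNr; field; rewrite gt_eqF.
have cF r : {for r, continuous F} by exact: isd_continuous (dF r).
have cf : continuous (fun r : R => expR (- (a * r))).
  move=> r; apply: (@isd_continuous _ _ _ (expR (- (a * r)) * - a)).
  rewrite (_ : (fun _ => _) = fun r => expR (- a * r)); last first.
    by apply/funext => u; rewrite mulNr.
  by rewrite -mulNr; exact: (isd_comp (is_derive_expR _) (isd_scale r (- a))).
rewrite /Rintegral (@continuous_FTC2 _ _ F 0 t) //=.
- rewrite /F mulr0 expR0 mulr1 !mulNr opprK gerDr oppr_le0.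
  by rewrite mulr_ge0 ?expR_ge0// invr_ge0 ltW.
- by apply: within_continuous_pt => r _; exact: cf.
- split=> [r _||].
  + by case: (dF r).
  + exact: (cvg_at_right_filter (cF 0)).
  + exact: (cvg_at_left_filter (cF t)).
- by move=> r _; rewrite derive1E; case: (dF r).
Qed.

Lemma continuous_integrable_itv (f : R -> R) (t : R) :
  {within `[0, t], continuous f} ->
  lebesgue_measure.-integrable `[0, t] (EFin \o f).
Proof.
by move=> cf; apply: continuous_compact_integrable => //; exact: segment_compact.
Qed.

(** The transient contributes at most [b / c] whatever [t] is, so it disappears after division by
    [t]. *)
Lemma Rintegral_exp_bound (f : R -> R) (a b c t : R) : 0 < c -> 0 < t -> 0 <= b ->
  {within `[0, t], continuous f} ->
  (forall r, 0 <= r <= t -> `|f r| <= a + b * expR (- (c * r))) ->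
  `|\int[lebesgue_measure]_(r in `[0, t]) f r| <= a * t + b / c.
Proof.
move=> c0 t0 b0 cf fle.
have If := continuous_integrable_itv cf.
have cexp : {within `[0, t], continuous (fun r : R => expR (- (c * r)))}.
  apply: within_continuous_pt => r _.
  apply: (@isd_continuous _ _ _ (expR (- (c * r)) * - c)).
  rewrite (_ : (fun _ => _) = fun r => expR (- c * r)); last first.
    by apply/funext => u; rewrite mulNr.
  by rewrite -mulNr; exact: (isd_comp (is_derive_expR _) (isd_scale r (- c))).
have Iexp := continuous_integrable_itv cexp.
have Icst : lebesgue_measure.-integrable `[0, t] (EFin \o (fun _ : R => a)).
  by apply: continuous_integrable_itv => r; exact: cvg_cst.
have Ibexp : lebesgue_measure.-integrable `[0, t]
    (EFin \o (fun r : R => b * expR (- (c * r)))).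
  apply: continuous_integrable_itv => r; apply: cvgM; first exact: cvg_cst.
  exact: cexp.
apply: le_trans; first by apply: le_normr_Rintegral; [exact: measurable_itv|exact: If].
apply: (@le_trans _ _ (\int[lebesgue_measure]_(r in `[0, t]) (a + b * expR (- (c * r))))).
  apply: le_Rintegral.
  - exact: measurable_itv.
  - by apply: continuous_integrable_itv => r; apply: cvg_norm; exact: cf.
  - apply: continuous_integrable_itv => r; apply: cvgD; first exact: cvg_cst.
    by apply: cvgM; [exact: cvg_cst|exact: cexp].
  - by move=> r; rewrite /= in_itv/=; exact: fle.
rewrite RintegralD//; apply: lerD.
  rewrite Rintegral_cst//= lebesgue_measure_itv/= lte_fin t0/= subr0//.
rewrite RintegralZl// ler_wpM2l//; exact: Rintegral_expRN_le.
Qed.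

(** Freezing the path at its initial value for negative times makes continuity two-sided at 0.
    Absolute continuity is used with a single interval. *)
Lemma abs_continuous_max n (x : R -> 'cV[R]_n) t :
  loc_abs_continuous x -> mx_continuous t (fun r => x (Num.max 0 r)).
Proof.
move=> acx i j; rewrite ord1.
apply/cvgrPdist_lt => e e0.
pose b := Num.max 0 t + 1.
have m0 u : 0 <= Num.max 0 u :> R by rewrite le_max lexx.
have b0 : 0 <= b by rewrite addr_ge0.
have [d d0 xd] := acx b b0 e e0.
have close u v : 0 <= u -> u <= v -> v <= b -> v - u < d ->
    `|x v i 0 - x u i 0| < e.
  move=> u0 uv vb uvd.
  have := xd 1%N (fun=> u) (fun=> v) (fun _ _ => conj u0 (conj uv vb)).
  rewrite !big_ord1 => H; rewrite (le_lt_trans _ (H _ uvd))//.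
    by rewrite (le_trans _ (entry_le_enorm _ i))// !mxE.
  by move=> [|?] [|?].
apply/nbhs_ballP; exists (Num.min d 1) => /=; first by rewrite lt_min d0 ltr01.
move=> u; rewrite /ball/= lt_min distrC => /andP[utd ut1].
have := dist_max_le 0 u t; set M := Num.max 0 u; set N := Num.max 0 t => MN.
have MNd : `|M - N| < d by exact: le_lt_trans utd.
have MN1 : `|M - N| < 1 by exact: le_lt_trans ut1.
have [MleN|NltM] := leP M N.
  apply: close => //; rewrite ?/M ?m0//; first by rewrite /b lerDl.
  by rewrite (le_lt_trans (ler_norm _))// distrC.
rewrite distrC; apply: close; rewrite ?/N ?m0 ?(ltW NltM)//.
  by rewrite /b -lerBlDl (le_trans (ler_norm _))// ltW.
by rewrite (le_lt_trans (ler_norm _)).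
Qed.

End Asymptotics.

(** * Sampling and switching times *)

Section TimePartition.
Context {R : realType}.
Implicit Types (u : nat -> \bar R) (t : R).

(** One notion for sampling and switching: values are extended reals, since switching may stop, and
    strict growth is imposed only at finite terms. The last clause excludes accumulation of
    events. *)
Definition time_partition u := [/\ u 0%N = 0%E,
  forall k, (u k <= u k.+1)%E,
  forall k, (u k < +oo)%E -> (u k < u k.+1)%E
  & forall t, exists k, (t%:E < u k)%E].

Definition cell u k t := (u k <= t%:E)%E && (t%:E < u k.+1)%E.

(** The default 0 is returned only when no cell contains [t]; for a time partition this does not
    occur at nonnegative times. *)
Definition cell_index u t : nat := xget 0%N [set k | cell u k t].

Lemma partition_mono u k l : time_partition u -> (k <= l)%N -> (u k <= u l)%E.
Proof.
move=> [_ um _ _]; elim: l => [|l IH]; first by rewrite leqn0 => /eqP ->.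
by rewrite leq_eqVlt => /predU1P[->//|/IH H]; exact: le_trans (um l).
Qed.

Lemma cell_uniq u k l t : time_partition u -> cell u k t -> cell u l t -> k = l.
Proof.
move=> pu /andP[kt tk] /andP[lt_ tl]; apply/eqP.
rewrite eqn_leq leqNgt [X in _ && X]leqNgt; apply/andP; split; apply/negP => H.
  by have := partition_mono pu H; rewrite leNgt (le_lt_trans kt tl).
by have := partition_mono pu H; rewrite leNgt (le_lt_trans lt_ tk).
Qed.

Lemma cell_indexE u k t : time_partition u -> cell u k t -> cell_index u t = k.
Proof.
move=> pu ck; rewrite /cell_index.
by case: xgetP => [l _ cl|/(_ k)//]; exact: cell_uniq pu cl ck.
Qed.

Lemma cell_indexP u t : time_partition u -> 0 <= t -> cell u (cell_index u t) t.
Proof.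
move=> pu t0; rewrite /cell_index; case: xgetP => [l _ //|no]; exfalso.
have [u0 _ _ ucof] := pu.
have [[|k] tk kmin] := ex_minnP (ucof t).
  by move: tk; rewrite u0 lte_fin ltNge t0.
apply: (no k); rewrite /= /cell tk andbT leNgt; apply/negP => /kmin.
by rewrite ltnn.
Qed.

Lemma left_cell u t : time_partition u -> 0 < t ->
  exists k, (u k < t%:E)%E /\ (t%:E <= u k.+1)%E.
Proof.
move=> pu t0; have [u0 _ _ ucof] := pu.
have ex : exists k, (t%:E <= u k)%E by have [k /ltW] := ucof t; exists k.
have [[|k] tk kmin] := ex_minnP ex.
  by move: tk; rewrite u0 lee_fin leNgt t0.
exists k; split => //; rewrite ltNge; apply/negP => /kmin.
by rewrite ltnn.
Qed.

(** At an event the index advances by exactly one, because a finite term is strictly below its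
    successor. *)
Lemma left_cell_index u t k : time_partition u ->
  (u k < t%:E)%E -> (t%:E <= u k.+1)%E ->
  cell_index u t = k \/ (u k.+1 = t%:E /\ cell_index u t = k.+1).
Proof.
move=> pu kt; rewrite le_eqVlt => /predU1P[tk|tk]; [right|left].
  split=> //; apply: cell_indexE => //; rewrite /cell -tk lexx /= tk.
  by have [_ _ str _] := pu; apply: str; rewrite -tk ltry.
by apply: cell_indexE => //; rewrite /cell (ltW kt).
Qed.

Lemma partition_ge0 u k : time_partition u -> (0 <= u k)%E.
Proof. by move=> pu; have [<- _ _ _] := pu; exact: partition_mono. Qed.

Lemma partition_fin u k t : time_partition u -> (u k <= t%:E)%E ->
  u k = (fine (u k))%:E.
Proof.
move=> pu ut; rewrite fineK// fin_numE; apply/andP; split; apply/eqP => H.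
  by have := partition_ge0 k pu; rewrite H.
by move: ut; rewrite H.
Qed.

Lemma cell_right u k t : cell u k t -> \forall r \near t^'+, cell u k r.
Proof.
move=> /andP[kt tk].
have : \forall r \near t^'+, (r%:E < u k.+1)%E.
  case: (u k.+1) tk => [v| |] //; rewrite ?lte_fin; last first.
    by move=> _; apply: nearW => r; rewrite ltry.
  by move=> tv; near=> r; rewrite lte_fin; near: r; exact: nbhs_right_lt.
move=> H; near=> r; apply/andP; split; last by near: r.
by rewrite (le_trans kt)// lee_fin.
Unshelve. all: by end_near. Qed.

Lemma right_nbhs_itv t (P : R -> Prop) : (\forall r \near t^'+, P r) ->
  exists2 d, 0 < d & forall r, t < r < t + d -> P r.
Proof.
rewrite /at_right /within/= => /nbhs_ballP[d /= d0 dP]; exists d => // r /andP[tr rd].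
by apply: dP => //; rewrite /ball/= distrC gtr0_norm ?subr_gt0// ltrBlDl.
Qed.

(** Within a bounded window, [S] without [t] is finite, hence closed, and its complement is a
    neighbourhood of [t]. *)
Lemma locally_finite_right (S : set R) t : locally_finite S -> 0 <= t ->
  \forall r \near t^'+, ~ S r.
Proof.
move=> lfS t0; pose F := (S `&` `[0, t + 1]) `\ t.
have fF : finite_set F by apply: sub_finite_set (lfS (t + 1)) => r [].
have cF : closed F.
  by apply: accessible_finite_set_closed.1 fF; exact/hausdorff_accessible/Rhausdorff.
have nF : nbhs t (~` F).
  apply: open_nbhs_nbhs; split; first exact: closed_openC.
  by move=> [_]; apply.
have {}nF : \forall r \near t^'+, (~` F) r by apply: cvg_within.
near=> r => Sr.
have Fr : ~ F r by near: r.
have tr : t < r by [].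
have rt : r <= t + 1 by near: r; apply: nbhs_right_ltW; rewrite ltrDl.
apply: Fr; split; last by apply/eqP; rewrite gt_eqF.
by split=> //=; rewrite in_itv/= rt (le_trans t0 (ltW tr)).
Unshelve. all: by end_near. Qed.

Lemma sampling_partition (h : R) (s : nat -> R) : sampling_instants h s ->
  time_partition (fun k => (s k)%:E).
Proof.
move=> [s0 sk /cvgryPgt scof]; split => [|k|k _|t].
- by rewrite s0.
- by rewrite lee_fin -subr_ge0 ltW//; have /andP[] := sk k.
- by rewrite lte_fin -subr_gt0; have /andP[] := sk k.
have [N _ HN] := scof t; exists N; rewrite lte_fin; apply: HN => /=; exact: leqnn.
Qed.

End TimePartition.

Section SwitchingTimes.
Context {R : realType} {l : nat}.
Variables (T : R) (tsw : nat -> \bar R) (bad : nat -> set R).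
Hypothesis T0 : 0 < T.
Hypothesis tsw0 : tsw 0%N = 0%E.
Hypothesis tswS : forall k, tsw k.+1 =
  ereal_inf [set t%:E | t in [set t : R | (tsw k + T%:E < t%:E)%E /\ bad k t]].

Lemma dwell k : (tsw k + T%:E <= tsw k.+1)%E.
Proof.
rewrite leNgt; apply/negP; rewrite {1}tswS => /ereal_inf_lt[_ [t /= [kt _] <-]].
by rewrite ltNge (ltW kt).
Qed.

(** The dwell time gives k T <= [tsw k], which excludes infinitely many switches in bounded time. *)
Lemma switching_partition : time_partition tsw.
Proof.
have ge k : ((k%:R * T)%:E <= tsw k)%E.
  elim: k => [|k IH]; first by rewrite tsw0 mul0r.
  apply: le_trans (dwell k); rewrite -natr1 mulrDl mul1r EFinD.
  exact: leeD.
have ge0 k : (0 <= tsw k)%E.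
  by apply: le_trans (ge k); rewrite lee_fin mulr_ge0// ltW.
have incr k : (tsw k < +oo)%E -> (tsw k < tsw k.+1)%E.
  move=> ky; apply: lt_le_trans (dwell k); rewrite lteDl// ?lte_fin//.
  by rewrite ge0_fin_numE.
split => // [k|t].
  have := leey (tsw k); rewrite le_eqVlt => /predU1P[ky|/incr /ltW//].
  by have := dwell k; rewrite ky.
exists (Num.truncn (`|t| / T)).+1; apply: lt_le_trans (ge _).
rewrite lte_fin -ltr_pdivrMr// (le_lt_trans _ (truncnS_gt _))//.
by rewrite ler_pM2r ?invr_gt0// ler_norm.
Qed.

(* A finite switching time is a limit of bad times from the right. *)
Lemma switch_violated k (good : set R) :
  (tsw k.+1 < +oo)%E -> (forall t, good t -> ~ bad k t) ->
  ~ (\forall t \near fine (tsw k.+1), good t).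
Proof.
move=> kfin gb /nbhs_ballP[e /= e0 he].
have tk : tsw k.+1 = (fine (tsw k.+1))%:E.
  rewrite fineK// ge0_fin_numE//.
  exact: partition_ge0 switching_partition.
have : (tsw k.+1 < (fine (tsw k.+1) + e)%:E)%E by rewrite {1}tk lte_fin ltrDl.
rewrite {1}tswS => /ereal_inf_lt[_ [t /= [kt bt] <-]]; rewrite lte_fin => te.
have : (tsw k.+1 <= t%:E)%E.
  by rewrite tswS; apply: ereal_inf_lbound; exists t.
rewrite tk lee_fin => tget; apply: (gb t) => //; apply: he.
by rewrite /ball/= distrC ger0_norm ?subr_ge0// ltrBlDl.
Qed.

End SwitchingTimes.

Section RightLipschitz.
Context {R : realType}.

(* The derivative bound is obtained from its continuous extension to [a]. *)
Lemma right_lipschitz (f df : R -> R) (a : R) :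
  (\forall r \near a^'+, is_derive (r : R) 1 f (df r)) ->
  {for a, continuous f} -> {for a, continuous df} ->
  exists M, \forall r \near a^'+, `|f r - f a| <= M * (r - a).
Proof.
move=> fd cf cdf; pose M := `|df a| + 1; exists M.
have dfM : \forall r \near a^'+, `|df r| <= M.
  have : \forall r \near a, `|df r| < M.
    by apply: (cvgr_lt _ (cvg_norm cdf)); rewrite ltrDl.
  by move=> H; apply: cvg_within; apply: filterS H => r /ltW.
have [d d0 H] := right_nbhs_itv (filterI fd dfM).
near=> r; have ar : a < r by [].
have rd : r < a + d by near: r; apply: nbhs_right_lt; rewrite ltrDl.
have H' q : a < q < r -> is_derive (q : R) 1 f (df q) /\ `|df q| <= M.
  by move=> /andP[aq qr]; apply: H; rewrite aq (lt_trans qr).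
have cont q : a <= q <= r -> {for q, continuous f}.
  move=> /andP[]; rewrite le_eqVlt => /predU1P[<-//|aq qr].
  have [] := H q; first by rewrite aq (le_lt_trans qr).
  by move=> /isd_continuous.
have up : f r + - M * r <= f a + - M * a.
  apply: (isd_le0_nonincr (f := fun q => f q + - M * q) (df := fun q => df q + - M)
    (ltW ar)) => q.
  - by move=> /H'[fq _]; apply: isd_add => //; exact: isd_scale.
  - by move=> /H'[_]; rewrite ler_norml => /andP[? ?]; lra.
  - move=> aqr; apply: cvgD; first exact: cont.
    exact: isd_continuous (isd_scale q (- M)).
have lo : - f r + - M * r <= - f a + - M * a.
  apply: (isd_le0_nonincr (f := fun q => - f q + - M * q)
    (df := fun q => - df q + - M) (ltW ar)) => q.
  - by move=> /H'[fq _]; apply: isd_add; [exact: is_deriveN|exact: isd_scale].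
  - by move=> /H'[_]; rewrite ler_norml => /andP[? ?]; lra.
  - move=> aqr; apply: cvgD; first by apply: cvgN; exact: cont.
    exact: isd_continuous (isd_scale q (- M)).
by rewrite ler_norml; apply/andP; split; lra.
Unshelve. all: by end_near. Qed.

End RightLipschitz.

Section GainTerm.
Context {R : realType} {n : nat}.
Variables (alpha h : R) (W : 'M[R]_n) (e : R -> 'cV[R]_n) (a : R).
Hypotheses (alpha0 : 0 < alpha) (h0 : 0 < h) (W_pd : posdef W).

(** The value 0 up to [a] is the reset at a sampling instant and also the limit from the right, so
    that the pole of [gain] leaves a function continuous at [a]. *)
Definition gain_term (t : R) : R :=
  if t <= a then 0 else gain alpha h (t - a) * qform W (e t - e a).

Let WT : W^T = W. Proof. by case: W_pd. Qed.

Let W_ge0 x : 0 <= qform W x.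
Proof. by have [_] := posdef_possemidef W_pd. Qed.

Lemma gain_term_ge0 t : t - a <= h -> 0 <= gain_term t.
Proof.
move=> th; rewrite /gain_term; case: (leP t a) => // at_.
by rewrite mulr_ge0// gain_ge0// subr_gt0 at_.
Qed.

Let gain_term_near t : a < t ->
  \forall r \near t, gain alpha h (r - a) * qform W (e r - e a) = gain_term r.
Proof.
move=> at_; near=> r; rewrite /gain_term ifF//; apply/negbTE; rewrite -ltNge.
by near: r; exact: lt_nbhsr.
Unshelve. all: by end_near. Qed.

Lemma gain_term_derive t de : 0 < t - a <= h -> mx_derive t e de ->
  is_derive t 1 gain_term (dgain alpha h (t - a) * qform W (e t - e a)
    + gain alpha h (t - a) * (2 * bform W (e t - e a) de)).
Proof.
move=> tah ed; have at_ : a < t by rewrite -subr_gt0; have /andP[] := tah.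
apply: (near_eq_is_derive (gain_term_near at_)).
apply: isd_mul; first exact: isd_shift (gain_derive alpha h0 tah).
have ev : mx_derive t (fun r => e r - e a) de.
  by have := mx_derive_add ed (mx_derive_cst t (- e a)); rewrite addr0.
have := qform_derive WT (mx_derive_cst t W) ev.
by rewrite [in X in X -> _]qformE bform0m add0r.
Qed.

Lemma gain_term_continuous t : 0 < t - a <= h -> mx_continuous t e ->
  {for t, continuous gain_term}.
Proof.
move=> tah ce; have at_ : a < t by rewrite -subr_gt0; have /andP[] := tah.
have H : {for t, continuous (fun r => gain alpha h (r - a) * qform W (e r - e a))}.
  apply: cvgM; first exact: isd_continuous (isd_shift (gain_derive alpha h0 tah)).
  apply: qform_continuous; first exact: mx_continuous_cst.
  by apply: mx_continuous_add => //; exact: mx_continuous_cst.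
suff : gain_term r @[r --> t] --> gain_term t by [].
rewrite -[X in _ --> X](nbhs_singleton (gain_term_near at_)).
by apply: cvg_trans H; apply: near_eq_cvg; exact: gain_term_near.
Qed.

(** A double zero beats a simple pole: the quadratic form is O((r - a)^2) and [gain] is O(1 / (r -
    a)), so the product is O(r - a). *)
Lemma gain_term_continuous_start :
  (forall i, exists M, \forall r \near a^'+, `|e r i 0 - e a i 0| <= M * (r - a)) ->
  {for a, continuous gain_term}.
Proof.
move=> lip; have /choice[M HM] := lip.
pose K := opnorm W * (\sum_i M i) ^+ 2 * (expR (2 * alpha * h) * h ^+ 2).
have K0 : 0 <= K.
  by apply: mulr_ge0; apply: mulr_ge0; rewrite ?opnorm_ge0 ?sqr_ge0 ?expR_ge0.
have G0 : gain_term a = 0 by rewrite /gain_term lexx.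
have bound : \forall r \near a^'+, `|gain_term r| <= K * (r - a).
  have HMi : \forall r \near a^'+, forall i, `|e r i 0 - e a i 0| <= M i * (r - a).
    exact: filter_forall.
  near=> r; have ar : a < r by [].
  have rh : 0 < r - a <= h.
    by rewrite subr_gt0 ar/= ltW//; near: r; exact: nbhs_right_ltDr.
  have Hr : forall i, `|e r i 0 - e a i 0| <= M i * (r - a) by near: r.
  rewrite /gain_term ifF; last by apply/negbTE; rewrite -ltNge.
  rewrite ger0_norm; last by apply: mulr_ge0 => //; exact: gain_ge0.
  have q : qform W (e r - e a) <= opnorm W * (\sum_i M i) ^+ 2 * (r - a) ^+ 2.
    rewrite (le_trans (ler_norm _))// qformE (le_trans (bform_opnorm _ _ _))//.
    rewrite -mulrA ler_wpM2l ?opnorm_ge0// -expr2 -exprMn.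
    have : enorm (e r - e a) <= (\sum_i M i) * (r - a).
      rewrite (le_trans (enorm_le_sum _))// mulr_suml ler_sum// => i _.
      by rewrite !mxE.
    move=> H; rewrite ler_pXn2r ?nnegrE ?enorm_ge0//.
    exact: le_trans (enorm_ge0 _) H.
  apply: (le_trans (ler_wpM2l (gain_ge0 alpha h0 rh) q)).
  rewrite [leLHS](_ : _ = opnorm W * (\sum_i M i) ^+ 2 * (r - a) *
    (gain alpha h (r - a) * (r - a))); last by ring.
  rewrite [leRHS](_ : _ = opnorm W * (\sum_i M i) ^+ 2 * (r - a) *
    (expR (2 * alpha * h) * h ^+ 2)); last by rewrite /K; ring.
  apply: ler_wpM2l; last exact: gain_le.
  by rewrite mulr_ge0 ?subr_ge0 ?(ltW ar)// mulr_ge0 ?opnorm_ge0 ?sqr_ge0.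
have [d d0 Hd] := right_nbhs_itv bound.
apply/cvgrPdist_lt => eps eps0.
(* [K + 1] replaces [K], which may be 0. *)
apply/nbhs_ballP; exists (Num.min d (eps / (K + 1))) => /=.
  by rewrite lt_min d0 divr_gt0// ltr_wpDl.
move=> r; rewrite /ball/= lt_min G0 sub0r normrN => /andP[rd rK].
have [ra|ar] := leP r a; first by rewrite /gain_term ra normr0.
move: rd rK; rewrite distrC gtr0_norm ?subr_gt0// ltrBlDl => rd.
rewrite ltr_pdivlMr ?ltr_wpDl// => rK.
apply: (le_lt_trans (Hd r _)); first by rewrite ar.
apply: le_lt_trans rK; rewrite mulrC ler_wpM2l ?subr_ge0 ?(ltW ar)//.
by rewrite lerDl.
Unshelve. all: by end_near. Qed.

End GainTerm.

(** * The Lyapunov function of the closed loop *)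

Section ExtendedVectors.
Context {R : realType} {n m : nat}.

Lemma bform_sumM (I : finType) (P : pred I) k (F : I -> 'M[R]_k) x y :
  bform (\sum_(j | P j) F j) x y = \sum_(j | P j) bform (F j) x y.
Proof.
apply: (big_morph (fun M => bform M x y)) => [M N|]; first exact: bformDm.
exact: bform0m.
Qed.

Lemma qform_gram k q (M : 'M[R]_(q, k)) x : qform (M^T *m M) x = enorm (M *m x) ^+ 2.
Proof. by rewrite enorm_sqr qformE bformMl trmxK -{1}[M]mul1mx bformMr. Qed.

Lemma qform_lyapunov k (B M : 'M[R]_k) x : M^T = M ->
  qform (B^T *m M) x + qform (M *m B) x = 2 * bform M x (B *m x).
Proof.
by move=> MT; rewrite !qformE bformMl trmxK bformMr (bformC _ _ MT); ring.
Qed.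

(** Expand the form at c d - g v and divide by c. The coefficient g^2 / c is the quadratic term of
    the Riccati inequality. *)
Lemma young_qform k (W : 'M[R]_k) (c g : R) v d : possemidef W -> 0 < c ->
  2 * g * bform W v d <= c * qform W d + g ^+ 2 / c * qform W v.
Proof.
move=> [WT W_ge0] c0; have := W_ge0 (c *: d - g *: v).
rewrite qformE !(bformDl, bformDr, bformNl, bformNr, bformZl, bformZr).
rewrite (bformC d v WT) -!qformE => sq.
rewrite -(ler_pM2l c0) mulrDr [X in _ <= _ + X](_ : _ = g ^+ 2 * qform W v).
  lra.
by field; rewrite gt_eqF.
Qed.

Lemma qform_extE (phi : 'cV[R]_n) : qform (extE (n := n)) (extv phi) = 1.
Proof.
by rewrite qformE /extE /extv bform_block !bform0m !add0r bform1E big_ord1 !mxE mulr1.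
Qed.

Lemma qform_extv_scalar (c : R) (phi : 'cV[R]_n) :
  qform c%:M (extv phi) = c * (enorm phi ^+ 2 + 1).
Proof.
rewrite qformE bform_scalar enorm_sqr; congr (_ * _).
rewrite (@scalar_mx_block _ n 1 1) bform_block !bform0m !addr0.
by rewrite [X in _ + X]bform1E big_ord1 !mxE mulr1.
Qed.

Lemma mulmx_extA (A : 'M[R]_n) b phi :
  extA A b *m extv phi = col_mx (A *m phi + b) 0.
Proof. by rewrite /extA /extv mul_block_col !mul0mx addr0 mulmx1. Qed.

Lemma mulmx_extL (L : 'M[R]_(n, m)) (D : 'M[R]_(m, n)) (e : 'cV[R]_n) :
  extL L *m D *m e = col_mx (L *m D *m e) 0.
Proof. by rewrite /extL !mul_col_mx !mul0mx. Qed.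

Lemma mx_derive_extv t (phi : R -> 'cV[R]_n) d :
  mx_derive t (fun r => extv (phi r)) (col_mx d 0) -> mx_derive t phi d.
Proof.
move=> ed i j; have := ed (lshift 1 i) j; rewrite col_mxEu.
by under eq_fun do rewrite col_mxEu.
Qed.

Lemma mx_continuous_extv t (phi : R -> 'cV[R]_n) :
  mx_continuous t phi -> mx_continuous t (fun r => extv (phi r)).
Proof.
move=> cphi i j; case: (split_ordP i) => k ->.
  rewrite (_ : (fun r => _) = fun r => phi r k j); first exact: cphi.
  by apply/funext => r; rewrite col_mxEu.
rewrite (_ : (fun r => _) = fun=> (1%:M : 'M[R]_1) k j); first exact: cvg_cst.
by apply/funext => r; rewrite col_mxEd.
Qed.

End ExtendedVectors.

Section LyapunovFunction.
Context {R : realType} {n m p l : nat}.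
Variables (A : 'I_l -> 'M[R]_n) (b : 'I_l -> 'cV[R]_n).
Variables (D : 'I_l -> 'M[R]_(m, n)) (C : 'M[R]_(p, n)).
Variables (L : 'I_l -> 'M[R]_(n, m)) (f : 'I_l -> 'cV[R]_n -> 'cV[R]_n).
Variables (kappa eps zeta T h alpha : R).
Variables (X : 'I_l -> 'M[R]_n) (Pi : 'M[R]_l) (P : 'I_l -> R -> 'M[R]_(n + 1)).
Variables (Q W : 'M[R]_n) (gamma C1 : R).
Hypotheses (kappa_gt0 : 0 < kappa) (eps_gt0 : 0 < eps).
Hypotheses (T_gt0 : 0 < T) (h_gt0 : 0 < h) (alpha_gt0 : 0 < alpha).
Hypothesis f0 : forall i, f i 0 = 0.
Hypothesis f_lip : forall i (x y : 'cV[R]_n),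
  enorm (f i x - f i y) <= kappa * enorm (x - y).
Hypothesis Pi_rate : rate_matrix Pi.
Let Y j := Y1 zeta T (A j) (b j) (X j) + Y2 zeta T (A j) (b j) C.
Hypothesis lmi : forall i,
  mxlt ((extA (A i) (b i))^T *m extX (X i) + extX (X i) *m extA (A i) (b i)
        + \sum_(j | j != i) Pi i j *: (Y j - extX (X i))
        + (extC C)^T *m extC C + (2 * zeta) *: extX (X i))
       (eps *: extE).
Hypothesis P_sol : forall i, is_Pbar zeta T (A i) (b i) C (X i) (P i).
Hypotheses (Q_pd : posdef Q) (W_pd : posdef W) (gamma_gt0 : 0 < gamma).
Hypothesis Psi_neg : forall i (t : R), 0 <= t <= T ->
  mxlt (Psi zeta alpha gamma kappa h Q W (A i) (D i) (L i) (P i t)) 0.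
Hypothesis P_lb : forall i (t : R), 0 <= t <= T -> mxle C1%:M (P i t).

Variables (s : nat -> R) (sigma : R -> 'I_l) (x phi : R -> 'cV[R]_n) (S : set R).
Hypothesis s_sampling : sampling_instants h s.
Hypotheses (x_cont : forall t, mx_continuous t x)
           (phi_cont : forall t, mx_continuous t phi).
Hypothesis S_fin : locally_finite S.
Hypothesis flow : forall k t, s k <= t < s k.+1 -> 0 < t -> ~ S t ->
  mx_derive t x (A (sigma t) *m x t + b (sigma t) + f (sigma t) (x t)) /\
  mx_derive t (fun r => extv (phi r))
    (extA (A (sigma t)) (b (sigma t)) *m extv (phi t)
     + extL (L (sigma t)) *m D (sigma t) *m (x (s k) - phi (s k))).

Variables (tsw : nat -> \bar R) (mode : nat -> 'I_l).
Let bad k : set R := [set t | exists2 j, j != mode k &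
  qform (Y j - extX (X (mode k))) (extv (phi t)) < 0].
Hypothesis tsw0 : tsw 0%N = 0%E.
Hypothesis tsw_mode : forall k (t : R),
  (tsw k <= t%:E)%E -> (t%:E < tsw k.+1)%E -> sigma t = mode k.
Hypothesis tswS : forall k, tsw k.+1 =
  ereal_inf [set t%:E | t in [set t : R | (tsw k + T%:E < t%:E)%E /\ bad k t]].
Hypothesis tsw_argmin : forall k, (tsw k.+1 < +oo)%E -> forall j, j != mode k ->
  qform (Y (mode k.+1)) (extv (phi (fine (tsw k.+1))))
    <= qform (Y j) (extv (phi (fine (tsw k.+1)))).

Let su k := (s k)%:E.
Let e t := x t - phi t.

Let YP j : Y j = P j 0.
Proof. exact: Pbar_initial T_gt0 (P_sol j). Qed.

Let PT i : P i T = extX (X i).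
Proof. by case: (P_sol i). Qed.

Let P_sym i t : 0 <= t <= T -> (P i t)^T = P i t.
Proof.
move=> /(P_lb i)[]; rewrite linearB/= tr_scalar_mx => /eqP.
by rewrite subr_eq subrK => /eqP.
Qed.

Let su_part : time_partition su.
Proof. exact: sampling_partition s_sampling. Qed.

Let tsw_part : time_partition tsw.
Proof. exact: switching_partition T_gt0 tsw0 tswS. Qed.

Let s_ge0 k : 0 <= s k.
Proof. by have := partition_ge0 k su_part; rewrite lee_fin. Qed.

Let e_cont t : mx_continuous t e.
Proof. by apply: mx_continuous_add => //; exact: mx_continuous_opp. Qed.

(** With the sampling index and the mode held fixed, the right-hand side of the error equation is
    continuous on the whole line. It thus extends the derivative of [e] continuously to the start of
    a sampling interval. *)
Definition error_field k i t : 'cV[R]_n :=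
  (A i - L i *m D i) *m e t + L i *m D i *m (e t - e (s k)) + f i (x t).

(** The indices are frozen so that the same smooth expression can be followed up to and across the
    end of a cell; the actual Lyapunov function selects them from the current time. *)
Definition lyapunov k j t : R :=
  qform (P (mode j) (clamp 0 T (t - fine (tsw j)))) (extv (phi t))
  + qform Q (e t) + gain_term alpha h W e (s k) t.

(** The sampled error e(s_k) is written as e - (e - e(s_k)) to match the form e - v in
    [Psi_dissipation]. *)
Lemma mode_flow k j t : cell su k t -> cell tsw j t -> 0 < t -> ~ S t ->
  mx_derive t e (error_field k (mode j) t) /\
  mx_derive t (fun r => extv (phi r))
    (extA (A (mode j)) (b (mode j)) *m extv (phi t)
     + extL (L (mode j)) *m D (mode j) *m (e t - (e t - e (s k)))).
Proof.
move=> /andP[+ +] /andP[jt tj] t0 St; rewrite lee_fin lte_fin => kt tk.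
have [xd phid] := flow (introT andP (conj kt tk)) t0 St.
rewrite (tsw_mode jt tj) in xd phid; rewrite subKr; split => //.
have phid' : mx_derive t phi (A (mode j) *m phi t + b (mode j)
    + L (mode j) *m D (mode j) *m e (s k)).
  by apply: mx_derive_extv; rewrite -[X in col_mx _ X]addr0 -add_col_mx
    -mulmx_extA -mulmx_extL.
have := mx_derive_add xd (mx_derive_opp phid'); rewrite /error_field.
congr mx_derive; rewrite /e mulmxBl !mulmxBr.
set LDx := _ *m x (s k); set LDp := _ *m phi (s k).
by apply/matrixP => i q; rewrite !mxE; ring.
Qed.

Lemma error_field_continuous k i t : mx_continuous t (error_field k i).
Proof.
apply: mx_continuous_add; first apply: mx_continuous_add.
- by apply: mx_continuous_mul; [exact: mx_continuous_cst|exact: e_cont].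
- apply: mx_continuous_mul; first exact: mx_continuous_cst.
  by apply: mx_continuous_add; [exact: e_cont|exact: mx_continuous_cst].
- apply: (lipschitz_mx_continuous (kappa := kappa) (f := f i)) => //.
  exact: ltW.
Qed.

Lemma error_right_lipschitz k i :
  exists M, \forall r \near (s k)^'+, `|e r i 0 - e (s k) i 0| <= M * (r - s k).
Proof.
have ck : cell su k (s k).
  rewrite /cell lexx/= lte_fin -subr_gt0; have [_ sk _] := s_sampling.
  by have /andP[] := sk k.
have cj := cell_indexP tsw_part (s_ge0 k); set j := cell_index _ _ in cj.
apply: (right_lipschitz (df := fun r => error_field k (mode j) r i 0)).
- have := cell_right ck; have := cell_right cj.
  have := locally_finite_right S_fin (s_ge0 k).
  move=> H1 H2 H3; near=> r.
  have [] := @mode_flow k j r; [by near: r|by near: r| |by near: r|].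
    by rewrite (le_lt_trans (s_ge0 k)).
  by move=> + _; apply.
- exact: e_cont.
- exact: error_field_continuous.
Unshelve. all: by end_near. Qed.

Lemma lyapunov_continuous k j t : s k <= t -> t - s k <= h ->
  {for t, continuous (lyapunov k j)}.
Proof.
move=> kt th; apply: cvgD; first apply: cvgD.
- apply: qform_continuous; last exact: mx_continuous_extv.
  apply: (mx_continuous_shift (M := fun r => P (mode j) (clamp 0 T r))).
  exact: Pbar_continuous T_gt0 (P_sol _) _.
- by apply: qform_continuous; [exact: mx_continuous_cst|exact: e_cont].
- move: kt; rewrite le_eqVlt => /predU1P[<-|kt].
    apply: gain_term_continuous_start => //; exact: error_right_lipschitz.
  by apply: gain_term_continuous => //; rewrite subr_gt0 kt.
Qed.

(* During the dwell phase the Lyapunov equation of [P] is used, and afterwards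
   the LMI, whose sum is nonnegative since no switch has been triggered. *)
Lemma lyapunov_P_derive j t u : cell tsw j t ->
  (0 < t - fine (tsw j) < T \/ T < t - fine (tsw j)) ->
  mx_derive t (fun r => extv (phi r))
    (extA (A (mode j)) (b (mode j)) *m extv (phi t) + u) ->
  let Pj r := P (mode j) (clamp 0 T (r - fine (tsw j))) in
  exists2 dV, is_derive t 1 (fun r => qform (Pj r) (extv (phi r))) dV &
    dV <= - (2 * zeta) * qform (Pj t) (extv (phi t))
      + 2 * bform (Pj t) (extv (phi t)) u + eps.
Proof.
move=> /andP[jt tj] phase phid Pj; set tau := fine (tsw j) in phase Pj *.
have Psym : (Pj t)^T = Pj t by apply: P_sym; exact: clamp_itv (ltW T_gt0).
have [dwell_phase|free_phase] := phase.
  have /andP[/ltW t0 /ltW tT] := dwell_phase.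
  have dP := mx_derive_shift (Pbar_derive (P_sol (mode j)) dwell_phase).
  have := qform_derive Psym dP phid; set dV := (X in is_derive _ _ _ X) => dVP.
  exists dV => //; rewrite /dV /Pj clamp_id ?t0//.
  have := P_sym (mode j) (introT andP (conj t0 tT)); move: (P _ _) => M MT.
  (* The drift cancels against the derivative of [P], leaving - |C phi|^2 besides the decay and
     input terms; [eps] is mere slack in this phase. *)
  have Cge0 : 0 <= enorm (extC C *m extv (phi t)) ^+ 2 by rewrite sqr_ge0.
  rewrite !qformE bformNm !bformDm bformZm -!qformE qform_gram.
  rewrite bformDr qform_lyapunov//.
  move: Cge0 eps_gt0; move: (bform M _ (extA _ _ *m _)) (bform M _ u) (qform M _).
  move: (enorm _ ^+ 2) => c1 c2 c3 c4; lra.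
have dP := mx_derive_shift (Pbar_derive_ge (P (mode j)) T_gt0 free_phase).
have := qform_derive Psym dP phid; set dV := (X in is_derive _ _ _ X) => dVP.
exists dV => //; rewrite /dV /Pj clamp_ge ?(ltW T_gt0) ?(ltW free_phase)// PT.
have XT : (extX (X (mode j)))^T = extX (X (mode j)).
  by rewrite -PT P_sym// lexx ltW.
have := mxlt_qform (extv (phi t)) (lmi (mode j)).
rewrite !qformE !bformDm !bformZm bform0m bform_sumM -!qformE qform_extE qform_gram.
rewrite qform_lyapunov// bformDr.
have Cge0 : 0 <= enorm (extC C *m extv (phi t)) ^+ 2 by rewrite sqr_ge0.
have : 0 <= \sum_(q | q != mode j)
    bform (Pi (mode j) q *: (Y q - extX (X (mode j)))) (extv (phi t)) (extv (phi t)).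
  apply: sumr_ge0 => q qj; rewrite bformZm mulr_ge0//.
    by have [_ Pi_ge0 _] := Pi_rate; apply: Pi_ge0; rewrite eq_sym.
  (* A negative term would put [t], already past the dwell time, into the trigger set, so the next
     switch would occur no later than [t]. *)
  rewrite leNgt; apply/negP => neg; move: tj; rewrite tswS ltNge => /negP; apply.
  apply: ereal_inf_lbound; exists t => //; split; last by exists q.
  by rewrite (partition_fin tsw_part jt) -EFinD lte_fin addrC -ltrBrDr.

lra.
Qed.

Lemma f_enorm i y : enorm (f i y) ^+ 2 <= kappa ^+ 2 * enorm y ^+ 2.
Proof.
rewrite -exprMn ler_pXn2r ?nnegrE ?mulr_ge0 ?enorm_ge0 ?(ltW kappa_gt0)//.
by have := f_lip i y 0; rewrite f0 !subr0.
Qed.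

(** Four inequalities add up: the estimate for the [P] term, the dissipation inequality, Young's
    inequality for the cross term, and the Riccati inequality multiplied by [qform W v]. *)
Lemma lyapunov_derive k j t : cell su k t -> cell tsw j t -> s k < t -> ~ S t ->
  (0 < t - fine (tsw j) < T \/ T < t - fine (tsw j)) ->
  exists2 dV, is_derive t 1 (lyapunov k j) dV &
    dV + 2 * alpha * lyapunov k j t <= eps.
Proof.
move=> ck cj kt St phase.
have t0 : 0 < t by exact: le_lt_trans kt.
have [ed phid] := mode_flow ck cj t0 St.
have th : 0 < t - s k <= h.
  rewrite subr_gt0 kt/=; move: ck => /andP[_]; rewrite lte_fin => /ltW tk.
  have [_ sk _] := s_sampling; have /andP[_] := sk k; apply: le_trans.
  by rewrite lerD2r.
have [QT _] := Q_pd; have [WT _] := W_pd.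
have [dP dPd dPle] := lyapunov_P_derive cj phase phid.
have dQ := qform_derive QT (mx_derive_cst t Q) ed.
have dG := gain_term_derive alpha h_gt0 W_pd th ed.
have dVd := isd_add (isd_add dPd dQ) dG.
eexists; first exact: dVd.
set v := e t - e (s k) in phid dPle *.
set de := error_field k (mode j) t.
have Pdom : 0 <= clamp 0 T (t - fine (tsw j)) <= T by exact: clamp_itv (ltW T_gt0).
have wle : enorm (f (mode j) (x t)) ^+ 2 <= kappa ^+ 2 * enorm (phi t + e t) ^+ 2.
  by rewrite addrC subrK; exact: f_enorm.
have diss := Psi_dissipation (P_sym (mode j) Pdom) QT WT gamma_gt0
  (Psi_neg (mode j) Pdom) wle (erefl (error_field k (mode j) t)).
rewrite -/de -/v in diss.
rewrite /lyapunov [in X in _ + X]/gain_term ifF; last by apply/negbTE; rewrite -ltNge.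
rewrite -/v.
set g := gain alpha h (t - s k) in dPle *.
have ric := gain_riccati alpha_gt0 h_gt0 th.
rewrite -/g in ric.
set c := h ^+ 2 * expR (2 * alpha * h) in diss ric.
have c0 : 0 < c by rewrite mulr_gt0 ?exprn_gt0 ?expR_gt0.
have Wv0 : 0 <= qform W v by have [_] := posdef_possemidef W_pd.
have ric' := ler_wpM2r Wv0 ric.
have cs := young_qform g v de (posdef_possemidef W_pd) c0.
have -> : qform 0 (e t) = 0 by rewrite qformE bform0m.
move: diss ric' cs dPle.
move: (bform (P _ _) _ _) (qform (P _ _) _) (bform Q _ _) (qform Q _) => y1 y2 y3 y4.
move: (bform W _ _) (qform W v) (qform W de) (dgain _ _ _) (pi ^+ 2 / 4).
move: (g ^+ 2 / c) => y5 y6 y7 y8 y9 y10; lra.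
Qed.

(** If the chosen mode were strictly above the old value, minimality would put every other mode
    there too. By continuity this would persist near [t], whereas [t] is a limit of trigger
    times. *)
Lemma switch_decrease j t : tsw j.+1 = t%:E ->
  qform (P (mode j.+1) 0) (extv (phi t)) <= qform (extX (X (mode j))) (extv (phi t)).
Proof.
move=> tj; have tfin : (tsw j.+1 < +oo)%E by rewrite tj ltry.
have amin := tsw_argmin tfin; rewrite tj /= in amin.
rewrite -YP leNgt; apply/negP => XltY.
pose good r := forall i, i != mode j ->
  0 < qform (Y i - extX (X (mode j))) (extv (phi r)).
apply: (@switch_violated _ T tsw bad T_gt0 tsw0 tswS j good tfin).
  by move=> r gr [i ij]; rewrite ltNge ltW// gr.
suff goodi i : \forall r \near t, i != mode j ->
    0 < qform (Y i - extX (X (mode j))) (extv (phi r)).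
  by rewrite tj /=; exact: filter_forall goodi.
have [->|ij] := eqVneq i (mode j); first by near=> r.
have ci : {for t, continuous (fun r =>
    qform (Y i - extX (X (mode j))) (extv (phi r)))}.
  by apply: qform_continuous; [exact: mx_continuous_cst|exact: mx_continuous_extv].
have pos : 0 < qform (Y i - extX (X (mode j))) (extv (phi t)).
  rewrite qformE bformDm bformNm subr_gt0 -!qformE.
  exact: lt_le_trans XltY (amin i ij).
by apply: filterS (cvgr_gt _ ci _ pos) => r ? _.
Unshelve. all: by end_near. Qed.

Definition closed_loop_lyapunov t := lyapunov (cell_index su t) (cell_index tsw t) t.

Lemma closed_loop_lyapunov_right t : 0 <= t -> exists (F dF : R -> R) d, [/\ 0 < d,
  forall r, t <= r < t + d -> closed_loop_lyapunov r = F r,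
  forall r, t < r < t + d -> is_derive r 1 F (dF r),
  forall r, t < r < t + d -> dF r + 2 * alpha * F r <= 2 * alpha * (eps / (2 * alpha))
  & {for t, continuous F}].
Proof.
have -> : 2 * alpha * (eps / (2 * alpha)) = eps by field; rewrite gt_eqF.
move=> t0.
have ck := cell_indexP su_part t0; have cj := cell_indexP tsw_part t0.
rewrite /closed_loop_lyapunov.
move: (cell_index su t) (cell_index tsw t) ck cj => k j ck cj.
have ckr := cell_right ck; have cjr := cell_right cj.
have Sr := locally_finite_right S_fin t0.
have taut : fine (tsw j) <= t.
  by have /andP[jt _] := cj; rewrite -lee_fin -(partition_fin tsw_part jt).
have skt : s k <= t by have /andP[] := ck; rewrite lee_fin.
(* Just to the right of any time the elapsed time avoids the corner at [T]: it is still below [T],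
   or already beyond. *)
have phase : \forall r \near t^'+,
    0 < r - fine (tsw j) < T \/ T < r - fine (tsw j).
  have [tT|Tt] := ltP (t - fine (tsw j)) T; near=> r; [left|right].
    rewrite subr_gt0 (le_lt_trans taut)//= ltrBlDr; near: r.
    by apply: nbhs_right_lt; rewrite -ltrBlDr.
  by rewrite (le_lt_trans Tt)// ltrD2r.
have [d d0 H] := right_nbhs_itv (filterI (filterI ckr cjr) (filterI Sr phase)).
exists (lyapunov k j), (fun r => 'D_1 (lyapunov k j) r), d.
have main r : t < r < t + d -> exists2 dV, is_derive (r : R) 1 (lyapunov k j) dV &
    dV + 2 * alpha * lyapunov k j r <= eps.
  move=> rd; have [[ckr' cjr'] [Sr' phr]] := H r rd.
  apply: lyapunov_derive => //; have /andP[tr _] := rd.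
  exact: le_lt_trans tr.
split=> //.
- move=> r /andP[]; rewrite le_eqVlt => /predU1P[<- _|tr rd].
    by rewrite (cell_indexE su_part ck) (cell_indexE tsw_part cj).
  have [[ckr' cjr'] _] := H r (introT andP (conj tr rd)).
  by rewrite (cell_indexE su_part ckr') (cell_indexE tsw_part cjr').
- by move=> r /main[dV dVr _]; apply: DeriveDef => //; case: dVr.
- by move=> r /main[dV [_ <-]].
- apply: lyapunov_continuous => //.
  have [_ sk _] := s_sampling; have /andP[_ skh] := sk k.
  rewrite (le_trans _ skh)// lerD2r; have /andP[_] := ck.
  by rewrite lte_fin => /ltW.
Unshelve. all: by end_near. Qed.

Lemma closed_loop_lyapunov_left t : 0 < t -> exists F d, [/\ 0 < d,
  forall r, t - d < r < t -> closed_loop_lyapunov r = F r,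
  {for t, continuous F} & closed_loop_lyapunov t <= F t].
Proof.
move=> t0.
have [k [kt tk]] := left_cell su_part t0; have [j [jt tj]] := left_cell tsw_part t0.
have jE := partition_fin tsw_part (ltW jt).
have skt : s k < t by rewrite -lte_fin.
have taut : fine (tsw j) < t by rewrite -lte_fin -jE.
have th : t - s k <= h.
  have [_ sk _] := s_sampling; have /andP[_ skh] := sk k.
  by rewrite (le_trans _ skh)// lerD2r -lee_fin.
exists (lyapunov k j), (Num.min (t - s k) (t - fine (tsw j))).
split.
- by rewrite lt_min !subr_gt0 skt.
- move=> r /andP[+ rt]; rewrite ltrBlDr -ltrBlDl lt_min !ltrD2l !ltrN2.
  move=> /andP[skr taur]; rewrite /closed_loop_lyapunov.
  rewrite (@cell_indexE _ su k) ?(@cell_indexE _ tsw j)//.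
    by rewrite /cell jE lee_fin (ltW taur)/= (lt_le_trans _ tj)// lte_fin.
  by rewrite /cell lee_fin (ltW skr)/= (lt_le_trans _ tk)// lte_fin.
- exact: lyapunov_continuous (ltW skt) th.
have G_le : gain_term alpha h W e (s (cell_index su t)) t
    <= gain_term alpha h W e (s k) t.
  have [->//|[tE ->]] := left_cell_index su_part kt tk.
  have -> : s k.+1 = t by case: tE.
  by rewrite {1}/gain_term lexx gain_term_ge0.
(* At a switch at least [T] has elapsed, so the old clamped time is [T], where [P] equals [extX],
   while the new clock reads 0. Together with [G_le] this also covers a switch at a sampling
   instant. *)
have P_le : qform (P (mode (cell_index tsw t))
      (clamp 0 T (t - fine (tsw (cell_index tsw t))))) (extv (phi t))
    <= qform (P (mode j) (clamp 0 T (t - fine (tsw j)))) (extv (phi t)).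
  have [->//|[tE ->]] := left_cell_index tsw_part jt tj.
  rewrite tE /= subrr clamp_id ?lexx ?(ltW T_gt0)//.
  rewrite (le_trans (switch_decrease tE))// clamp_ge ?PT//.
  rewrite (ltW T_gt0)/= lerBrDr -lee_fin EFinD -jE -tE addeC.
  exact: dwell tswS j.
by rewrite /closed_loop_lyapunov /lyapunov; apply: lerD => //; apply: lerD.
Qed.

Lemma lyapunov_ge (C3 t : R) : mxle C3%:M Q -> 0 <= t ->
  C1 * (enorm (phi t) ^+ 2 + 1) + C3 * enorm (e t) ^+ 2 <= closed_loop_lyapunov t.
Proof.
move=> Q_lb t0; have /andP[kt tk] := cell_indexP su_part t0.
rewrite /closed_loop_lyapunov /lyapunov.
move: (cell_index su t) (cell_index tsw t) kt tk => k j; rewrite lee_fin lte_fin.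
move=> kt tk; rewrite -[leLHS]addr0; apply: lerD; first apply: lerD.
- rewrite -qform_extv_scalar; apply: mxle_qform; apply: P_lb.
  exact: clamp_itv (ltW T_gt0).
- by have := mxle_qform (e t) Q_lb; rewrite !qformE bform_scalar enorm_sqr.
- apply: gain_term_ge0 => //; have [_ sk _] := s_sampling.
  by have /andP[_] := sk k; apply: le_trans; rewrite lerD2r ltW.
Qed.

(** The absolute value makes the coefficient of the exponential nonnegative, as the integral bound
    for the costs requires. *)
Lemma closed_loop_bound (C3 t : R) : 0 < C1 -> 0 < C3 -> mxle C3%:M Q -> 0 <= t ->
  enorm (phi t) ^+ 2 + enorm (e t) ^+ 2 + 1
    <= eps / (2 * alpha * Num.min C1 C3)
     + `|closed_loop_lyapunov 0| / Num.min C1 C3 * expR (- (2 * alpha * t)).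
Proof.
move=> C10 C30 Q_lb t0; set c := Num.min C1 C3.
have c0 : 0 < c by rewrite lt_min C10.
have Vt := jump_comparison closed_loop_lyapunov_right closed_loop_lyapunov_left t0.
have Vge := lyapunov_ge Q_lb t0.
have cle : c * (enorm (phi t) ^+ 2 + enorm (e t) ^+ 2 + 1) <=
    C1 * (enorm (phi t) ^+ 2 + 1) + C3 * enorm (e t) ^+ 2.
  rewrite addrAC mulrDr; apply: lerD; apply: ler_wpM2r.
  - by rewrite addr_ge0// sqr_ge0.
  - by rewrite ge_min lexx.
  - by rewrite sqr_ge0.
  - by rewrite ge_min lexx orbT.
rewrite -(ler_pM2l c0) (le_trans cle)// (le_trans Vge)// (le_trans Vt)//.
rewrite mulrDr [X in _ <= X + _](_ : _ = eps / (2 * alpha)); last first.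
  by field; rewrite !gt_eqF.
rewrite lerD2l mulrA ler_wpM2r ?expR_ge0// [leRHS](_ : _ = `|closed_loop_lyapunov 0|).
  rewrite lerBlDr (le_trans (ler_norm _))// lerDl divr_ge0 ?(ltW eps_gt0)//.
  by rewrite mulr_ge0// ltW.
by field; rewrite gt_eqF.
Qed.

End LyapunovFunction.

(** * Comparison of the two costs *)

Section Costs.
Context {R : realType} {n p : nat}.
Implicit Types (C : 'M[R]_(p, n)) (x phi : R -> 'cV[R]_n).

Lemma le_of_le_add_inv (a b K : R) : (forall t, 0 < t -> a <= b + K / t) -> a <= b.
Proof.
move=> abK; rewrite leNgt; apply/negP => ba.
pose t := (`|K| + 1) / (a - b).
have t0 : 0 < t by rewrite divr_gt0 ?subr_gt0// ltr_wpDl.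
have := abK _ t0; rewrite -lerBlDl ler_pdivlMr// /t mulrCA divff ?subr_eq0 ?gt_eqF//.
rewrite mulr1 => /le_trans/(_ (ler_norm K)); lra.
Qed.

(** With d = u - v the gap is 2 v^T M d + d^T M d, and 2 |v| |d| <= |v|^2 + |d|^2 gives the factor
    2. *)
Lemma qform_gap_le (M : 'M[R]_n) (u v : 'cV[R]_n) :
  M^T = M -> `|qform M u - qform M v|
    <= 2 * opnorm M * (enorm v ^+ 2 + enorm (u - v) ^+ 2).
Proof.
move=> MT; have -> : qform M u - qform M v = 2 * bform M v (u - v) + qform M (u - v).
  have := qformD v (u - v) MT; rewrite [v + _]addrC subrK => ->; lra.
rewrite (le_trans (ler_normD _ _))//.
have h1 := bform_opnorm M v (u - v); have h2 := bform_opnorm M (u - v) (u - v).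
rewrite normrM ger0_norm// qformE.
have M0 := opnorm_ge0 M.
have := sqr_ge0 (enorm v - enorm (u - v)); rewrite sqrrB => h3.
have h4 : 0 <= enorm v ^+ 2 by rewrite sqr_ge0.
have : opnorm M * (2 * (enorm v * enorm (u - v)) + enorm (u - v) * enorm (u - v))
    <= opnorm M * (2 * (enorm v ^+ 2 + enorm (u - v) ^+ 2)).
  by rewrite ler_wpM2l//; lra.
lra.
Qed.

Lemma Jcost_gap C x phi (t : R) : 0 < t ->
  (forall r, mx_continuous r (fun q => x (Num.max 0 q))) ->
  (forall r, mx_continuous r (fun q => phi (Num.max 0 q))) ->
  Jcost C x t - Jhat C phi t = t^-1 * \int[lebesgue_measure]_(r in `[0, t])
    (qform (C^T *m C) (x (Num.max 0 r)) - qform (C^T *m C) (phi (Num.max 0 r))).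
Proof.
move=> t0 cx cphi.
have If (y : R -> 'cV[R]_n) : (forall r, mx_continuous r y) ->
    lebesgue_measure.-integrable `[0, t] (EFin \o (fun r => qform (C^T *m C) (y r))).
  move=> cy; apply: continuous_integrable_itv; apply: within_continuous_pt => r _.
  by apply: qform_continuous => //; exact: mx_continuous_cst.
rewrite RintegralB//; [|exact: If|exact: If].
rewrite mulrBr; congr (_ * _ - _ * _); apply: eq_Rintegral => r;
  rewrite inE/= in_itv/= => /andP[r0 _]; rewrite max_r///qform.
  by rewrite trmx_mul !mulmxA.
by rewrite !mulmxA.
Qed.

Lemma Jcost_gap_le C x phi (B M a t : R) : 0 < a -> 0 <= M -> 0 < t ->
  (forall r, mx_continuous r (fun q => x (Num.max 0 q))) ->
  (forall r, mx_continuous r (fun q => phi (Num.max 0 q))) ->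
  (forall r, 0 <= r ->
    enorm (phi r) ^+ 2 + enorm (x r - phi r) ^+ 2 <= B + M * expR (- (a * r))) ->
  `|Jcost C x t - Jhat C phi t|
    <= 2 * opnorm (C^T *m C) * B + 2 * opnorm (C^T *m C) * M / a / t.
Proof.
move=> a0 M0 t0 cx cphi bound; set N := 2 * opnorm _.
have N0 : 0 <= N by rewrite mulr_ge0// opnorm_ge0.
rewrite Jcost_gap// normrM gtr0_norm ?invr_gt0// mulrC ler_pdivrMr//.
rewrite mulrDl [X in _ + X]divfK ?gt_eqF//.
apply: Rintegral_exp_bound => //; first by rewrite mulr_ge0.
  apply: within_continuous_pt => r _; apply: cvgB; apply: qform_continuous => //;
    exact: mx_continuous_cst.
move=> r /andP[r0 _]; rewrite max_r//.
have MT : (C^T *m C)^T = C^T *m C by rewrite trmx_mul trmxK.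
rewrite (le_trans (qform_gap_le _ _ MT))// -/N -mulrA -mulrDr ler_wpM2l//.
exact: bound.
Qed.

(** By the parallelogram identity the defect is |v - w|^2 with w = u - v. *)
Lemma enorm_sqr_le_split (u v : 'cV[R]_n) :
  enorm u ^+ 2 <= 2 * (enorm v ^+ 2 + enorm (u - v) ^+ 2).
Proof.
have -> : enorm u = enorm (v + (u - v)) by rewrite addrC subrK.
move: (u - v) => w; have := qform1_ge0 (v - w).
rewrite !enorm_sqr !(bformDl, bformDr, bformNl, bformNr) (bformC w v (trmx1 _ _)); lra.
Qed.

End Costs.

Theorem theorem2 (R : realType) (n m p l : nat)
  (A : 'I_l -> 'M[R]_n) (b : 'I_l -> 'cV[R]_n)
  (D : 'I_l -> 'M[R]_(m, n)) (C : 'M[R]_(p, n))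
  (L : 'I_l -> 'M[R]_(n, m)) (f : 'I_l -> 'cV[R]_n -> 'cV[R]_n)
  (kappa eps zeta T h alpha : R)
  (X : 'I_l -> 'M[R]_n) (Pi : 'M[R]_l)
  (P : 'I_l -> R -> 'M[R]_(n + 1))
  (Q W : 'M[R]_n) (gamma C1 C3 : R)
  (kappa_gt0 : 0 < kappa) (eps_gt0 : 0 < eps) (zeta_gt0 : 0 < zeta)
  (T_gt0 : 0 < T) (h_gt0 : 0 < h) (alpha_gt0 : 0 < alpha)
  (f0 : forall i, f i 0 = 0)
  (f_lip : forall i (x y : 'cV[R]_n), enorm (f i x - f i y) <= kappa * enorm (x - y))
  (obs : forall i, observable (A i) (D i))
  (hurw : forall i, Hurwitz (A i - L i *m D i))
  (quad_stab : exists (Omega : 'M[R]_n) (eta : R),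
    [/\ posdef Omega, 0 < eta
      & forall i, mxlt (Phi eta Omega (A i - L i *m D i)) 0])
  (X_pd : forall i, posdef (X i))
  (Pi_rate : rate_matrix Pi)
  (lmi : forall i,
    let Ai := extA (A i) (b i) in
    mxlt (Ai^T *m extX (X i) + extX (X i) *m Ai
          + \sum_(j | j != i) Pi i j *:
              (Y1 zeta T (A j) (b j) (X j) + Y2 zeta T (A j) (b j) C
               - extX (X i))
          + (extC C)^T *m extC C + (2 * zeta) *: extX (X i))
         (eps *: extE))
  (P_sol : forall i, is_Pbar zeta T (A i) (b i) C (X i) (P i))
  (Q_pd : posdef Q) (W_pd : posdef W) (gamma_gt0 : 0 < gamma)
  (Psi_neg : forall i (t : R), 0 <= t <= T ->
    mxlt (Psi zeta alpha gamma kappa h Q W (A i) (D i) (L i) (P i t)) 0)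
  (C1_gt0 : 0 < C1) (C3_gt0 : 0 < C3)
  (P_lb : forall i (t : R), 0 <= t <= T -> mxle C1%:M (P i t))
  (Q_lb : mxle C3%:M Q)
  (s : nat -> R) (sigma : R -> 'I_l) (x phi : R -> 'cV[R]_n)
  (s_sampling : sampling_instants h s)
  (sol : closed_loop_solution A b D C L f zeta T X s sigma x phi) :
  let B1 := eps / (2 * alpha * Num.min C1 C3) in
  [/\ (limsup_infty (fun t => enorm (phi t) ^+ 2 + enorm (x t - phi t) ^+ 2)%R
         <= B1%:E)%E,
      (limsup_infty (fun t => enorm (x t) ^+ 2)%R <= (2 * B1)%R%:E)%E
    & (limsup_infty (fun t => `|Jcost C x t - Jhat C phi t|)%R
         <= (3 * opnorm (C^T *m C) * B1 ^+ 2)%:E)%E].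

Proof.
move=> B1.
have [acx acphi _ [S S_fin flow] [tsw [mode [tsw0 tsw_mode tswS tsw_argmin]]]] := sol.
(* The Lyapunov argument assumes two-sided continuity at every real time, whereas a solution is only
   controlled for nonnegative times. *)
pose xe r := x (Num.max 0 r); pose phie r := phi (Num.max 0 r).
have xeE r : 0 <= r -> xe r = x r by move=> r0; rewrite /xe max_r.
have phieE r : 0 <= r -> phie r = phi r by move=> r0; rewrite /phie max_r.
have x_cont t : mx_continuous t xe by exact: abs_continuous_max.
have phi_cont t : mx_continuous t phie by exact: abs_continuous_max.
have su_part := sampling_partition s_sampling.
have s_ge0 k : 0 <= s k by have := partition_ge0 k su_part; rewrite lee_fin.
have tsw_part := switching_partition T_gt0 tsw0 tswS.
have flowe k t : s k <= t < s k.+1 -> 0 < t -> ~ S t ->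
  mx_derive t xe (A (sigma t) *m xe t + b (sigma t) + f (sigma t) (xe t)) /\
  mx_derive t (fun r => extv (phie r))
    (extA (A (sigma t)) (b (sigma t)) *m extv (phie t)
     + extL (L (sigma t)) *m D (sigma t) *m (xe (s k) - phie (s k))).
  move=> kt t0 St; have [xd phid] := flow k t kt t0 St.
  rewrite !xeE ?phieE ?(ltW t0)//.
  have tpos : \forall r \near t, 0 <= r by near=> r; apply: ltW; near: r; exact: lt_nbhsr.
  split=> i j.
    apply: (near_eq_is_derive _ (is_derive_mx xd i j)).
    by apply: filterS tpos => r r0; rewrite xeE.
  apply: (near_eq_is_derive _ (is_derive_mx phid i j)).
  by apply: filterS tpos => r r0; rewrite phieE.
pose Y j := Y1 zeta T (A j) (b j) (X j) + Y2 zeta T (A j) (b j) C.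
have tswSe k : tsw k.+1 = ereal_inf [set t%:E | t in
    [set t : R | (tsw k + T%:E < t%:E)%E /\
      [set t | exists2 j, j != mode k &
        qform (Y j - extX (X (mode k))) (extv (phie t)) < 0] t]].
  rewrite tswS; congr (ereal_inf (image _ _)).
  have t_ge0 t : (tsw k + T%:E < t%:E)%E -> 0 <= t.
    move=> kt; rewrite -lee_fin ltW// (le_lt_trans _ kt)//.
    by rewrite adde_ge0 ?(partition_ge0 k tsw_part)// lee_fin ltW.
  by apply/seteqP; split=> t /= [kt [j jk neg]]; split=> //; exists j => //;
    move: neg; rewrite phieE// t_ge0.
have tsw_argmine k : (tsw k.+1 < +oo)%E -> forall j, j != mode k ->
    qform (Y (mode k.+1)) (extv (phie (fine (tsw k.+1))))
      <= qform (Y j) (extv (phie (fine (tsw k.+1)))).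
  move=> /tsw_argmin[_ amin] j jk; rewrite phieE; first exact: amin.
  by rewrite fine_ge0// partition_ge0.
have bound := closed_loop_bound kappa_gt0 eps_gt0 T_gt0 h_gt0 alpha_gt0 f0 f_lip
  Pi_rate lmi P_sol Q_pd W_pd gamma_gt0 Psi_neg P_lb s_sampling x_cont phi_cont
  S_fin flowe tsw0 tsw_mode tswSe tsw_argmine C1_gt0 C3_gt0 Q_lb.
move: bound; rewrite -/B1; set M := _ / Num.min C1 C3 => bound.
have min0 : 0 < Num.min C1 C3 by rewrite lt_min C1_gt0.
have M0 : 0 <= M by rewrite divr_ge0 ?normr_ge0 ?ltW.
have a0 : 0 < 2 * alpha by rewrite mulr_gt0.
have state_bound t : 0 <= t ->
    enorm (phi t) ^+ 2 + enorm (x t - phi t) ^+ 2 + 1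
      <= B1 + M * expR (- (2 * alpha * t)).
  by move=> t0; have := bound t t0; rewrite xeE// phieE.
have decay t : 0 < t ->
    enorm (phi t) ^+ 2 + enorm (x t - phi t) ^+ 2 + 1 <= B1 + M / (2 * alpha) / t.
  move=> t0; rewrite (le_trans (state_bound t (ltW t0)))// lerD2l -[leRHS]mulrA.
  apply: ler_wpM2l => //.
  exact: expRN_le_inv.
(* Hence [B1 <= B1 ^+ 2], which turns a cost bound linear in [B1] into the
   quadratic one. *)
have B1_ge1 : 1 <= B1.
  apply: (le_of_le_add_inv (K := M / (2 * alpha))) => t t0.
  by rewrite (le_trans _ (decay t t0))// lerDr addr_ge0 ?sqr_ge0.
split.
- apply: (limsup_infty_le (K := M / (2 * alpha))) => t t0.
  by rewrite (le_trans _ (decay t t0))// lerDl.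
- apply: (limsup_infty_le (K := 2 * (M / (2 * alpha)))) => t t0.
  rewrite -mulrA -mulrDr (le_trans (enorm_sqr_le_split (x t) (phi t)))//.
  by rewrite ler_wpM2l// (le_trans _ (decay t t0))// lerDl.
- apply: (limsup_infty_le (K := 2 * opnorm (C^T *m C) * M / (2 * alpha))) => t t0.
  have gap : `|Jcost C x t - Jhat C phi t| <= 2 * opnorm (C^T *m C) * B1
      + 2 * opnorm (C^T *m C) * M / (2 * alpha) / t.
    apply: Jcost_gap_le => // r r0.
    by rewrite (le_trans _ (state_bound r r0))// lerDl.
  rewrite (le_trans gap)// lerD2r mulrAC [leRHS]mulrAC ler_wpM2r ?opnorm_ge0//.
  by apply: ler_pM => //; rewrite ?(le_trans ler01)// ?ler_nat// ler_eXnr.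
Unshelve. all: by end_near. Qed.
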